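(* Suppose $(f,c,\mathcal{X})$ is regular problem data and $\mathcal{A}$ is a constraint dissolving mapping for it. Then for any $x\in\mathcal{K}$, any $y\in\Omega_x$, and any $\beta\ge\beta_x$, it holds that $$\mathrm{dist}\left(0,\nabla h(y)+\mathcal{N}_{\mathcal{X}}(y)\right)\ \ge\ \frac{\sigma_{x,c}\,\beta}{8(M_{x,A}+M_{x,R}+1)}\,\|c(y)\|.$$ Therefore, if $y\in\Omega_x$ is a first-order stationary point of (CDP) (with such $\beta$), then $y$ is a first-order stationary point of (NCP).
   Context: **Problem.** $\mathcal{X}\subseteq\mathbb{R}^n$ is a closed convex set, $f:\mathbb{R}^n\to\mathbb{R}$, and $c:\mathcal{Y}\to\mathbb{R}^p$ where $\mathcal{Y}\subseteq\mathbb{R}^n$ is an open set containing $\mathcal{X}$. (NCP) is the problem $\min f(x)$ subject to $c(x)=0$, $x\in\mathcal{X}$, and $\mathcal{K}:=\{x\in\mathcal{X}: c(x)=0\}$. **Notation.** $\|\cdot\|$ is the $\ell_2$ vector norm / operator norm. $\mathcal{T}_{\mathcal{X}}(x)$, $\mathcal{N}_{\mathcal{X}}(x)$ are the tangent and normal cones of $\mathcal{X}$ at $x$; $\mathrm{aff}(\mathcal{X})$ is the affine hull; $\mathcal{E}:=\mathrm{aff}(\mathcal{X})-x$ (any $x\in\mathcal{X}$) is the associated linear subspace; $P_{\mathcal{E}}$ is the orthogonal projection matrix onto $\mathcal{E}$. $\nabla c(x)=[\nabla c_1(x),\dots,\nabla c_p(x)]\in\mathbb{R}^{n\times p}$ and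 $\nabla\mathcal{A}(x)=[\nabla\mathcal{A}_1(x),\dots,\nabla\mathcal{A}_n(x)]\in\mathbb{R}^{n\times n}$ are transposed Jacobians (the derivative of $\mathcal{A}$ on $\mathcal{X}$ being understood through an extension to a neighborhood of $\mathcal{X}$). $\nabla f(\mathcal{A}(x))$ means $\nabla f$ evaluated at $\mathcal{A}(x)$. $\sigma_r(\cdot)$ is the $r$-th largest singular value. $\mathrm{range}$ of a matrix is its column space. **Regular problem data.** $f$ is continuously differentiable with locally Lipschitz gradient on $\mathbb{R}^n$; $c$ is continuously differentiable with locally Lipschitz Jacobian on $\mathcal{Y}$; and there is $r>0$, independent of $x$, such that for every $x\in\mathcal{K}$ there is $\tau_x>0$ with: (a) $\dim\{\nabla c(y)^\top d: d\in\mathcal{E}\}=r$ for all $y\in\mathcal{Y}\cap\mathrm{aff}(\mathcal{X})$ with $\|y-x\|\le\tau_x$; (b) $\dim\{\nabla c(y)^\top d: d\in\mathcal{T}_{\mathcal{X}}(y)\cap-\mathcal{T}_{\mathcal{X}}(y)\}=r$ for all $y\in\mathcal{X}$ with $\|y-x\|\le\tau_x$. **Constraint dissolving mapping.** A mapping $\mathcal{A}:\mathcal{X}\to\mathbb{R}^n$ such that: (1) $\mathcal{A}$ is locally Lipschitz smooth (continuously differentiable with locally Lipschitz derivative) over $\mathcal{X}$; (2) $\mathcal{A}(x)=x$ and $\nabla\mathcal{A}(x)\nabla c(x)=0$ for all $x\in\mathcal{K}$; (3) there is a locally Lipschitz mapping $\mathcal{R}_{\mathcal{A}}:\mathcal{X}\to\mathbb{R}^{n\times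 n}$ with $\mathcal{R}_{\mathcal{A}}(x)=0$ for $x\in\mathcal{K}$, and for each $x\in\mathcal{K}$ there is $\omega_x>0$ such that $(\nabla\mathcal{A}(y)-I_n-\mathcal{R}_{\mathcal{A}}(y))v=0$ for all $y\in\mathcal{X}$ with $\|y-x\|\le\omega_x$ and all $v\in\mathcal{N}_{\mathcal{X}}(y)$. **(CDP).** $\min_{x\in\mathcal{X}} h(x):=f(\mathcal{A}(x))+\frac{\beta}{2}\|c(x)\|^2$, $\beta\ge0$; $\nabla h(x)=\nabla\mathcal{A}(x)\nabla f(\mathcal{A}(x))+\beta\nabla c(x)c(x)$. **Stationarity.** $x\in\mathcal{K}$ is a first-order stationary point of (NCP) if $0\in\nabla f(x)+\mathrm{range}(\nabla c(x))+\mathcal{N}_{\mathcal{X}}(x)$. $x\in\mathcal{X}$ is a first-order stationary point of (CDP) if $0\in\nabla h(x)+\mathcal{N}_{\mathcal{X}}(x)$. **Constants.** Let $\tilde{\mathcal{Y}}\subseteq\mathcal{Y}$ be an open set containing $\mathcal{X}$ such that for every $x\in\mathcal{M}:=\{y\in\tilde{\mathcal{Y}}\cap\mathrm{aff}(\mathcal{X}): c(y)=0\}$ the dimension of $\nabla c(\cdot)^\top\mathcal{E}$ is constant near $x$. Put $\pi(x):=\sigma_r(P_{\mathcal{E}}\nabla c(x))$. For $x\in\mathcal{K}$ let $\kappa_x>0$ be such that for all $y\in\mathrm{aff}(\mathcal{X})$ with $\|y-x\|\le\kappa_x$: $\mathrm{dist}(y,\mathcal{M})\le\frac{2}{\pi(x)}\|c(y)\|$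 and $\|P_{\mathcal{E}}\nabla c(y)c(y)\|\ge\frac{\pi(x)}{2}\|c(y)\|$ (such $\kappa_x$ exists). Let $\rho_x$ be the largest $\rho\in(0,\min\{\tau_x,\omega_x,\kappa_x\}]$ with $\inf\{\pi(y):y\in\mathcal{X},\|y-x\|\le\rho\}\ge\frac12\pi(x)$, and $\Theta_x:=\{y\in\mathcal{X}:\|y-x\|\le\rho_x\}$. Define $\sigma_{x,c}:=\pi(x)$ and, with suprema over $y\in\Theta_x$ (for ratios, over those $y$ with $c(y)\neq0$; these quantities are well defined and finite): $M_{x,f}:=\sup\|\nabla f(\mathcal{A}(y))\|$, $M_{x,c}:=\sup\|\nabla c(y)\|$, $M_{x,A}:=\sup\|\nabla\mathcal{A}(y)\|$, $M_{x,R}:=\sup\frac{\|\mathcal{R}_{\mathcal{A}}(y)\|}{\|c(y)\|}$, $M_{x,I}:=\sup\frac{\|P_{\mathcal{E}}\nabla\mathcal{A}(y)(\nabla\mathcal{A}(y)-I_n)\|}{\|c(y)\|}$, $M_{x,B}:=\sup\frac{\|\nabla\mathcal{A}(y)\nabla c(y)\|}{\|c(y)\|}$, and $L_{x,A}:=\sup_{y\neq z\in\Theta_x}\frac{\|\nabla\mathcal{A}(y)-\nabla\mathcal{A}(z)\|}{\|y-z\|}$. Then $\delta_x:=\min\left\{\rho_x,\frac{\sigma_{x,c}}{8(M_{x,R}M_{x,c}+M_{x,B})M_{x,c}},\frac1{M_{x,c}}\right\}$, $\Omega_x:=\{y\in\mathcal{X}:\|y-x\|\le\delta_x\}$, and 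$\beta_x:=\max\left\{\frac{8M_{x,f}(M_{x,I}+M_{x,R}M_{x,A})}{\sigma_{x,c}},\frac{M_{x,f}L_{x,A}(1+M_{x,A}+M_{x,A}^2)}{\sigma_{x,c}^2}\right\}$.
   Formalization: The second assertion (a stationary point of (CDP) is one of (NCP)) is stated for β > 0; for β = β_x = 0 it fails, e.g. X = Y = R, c(x) = x, f = 0, A = 0. The inequality is stated for every β ≥ 0 with β ≥ β_x. *)

(* Defs.v *)
From mathcomp Require Import all_boot all_order all_algebra.
From mathcomp Require Import all_classical all_reals all_analysis.
From mathcomp Require Import polyrcf.

Set Implicit Arguments.
Unset Strict Implicit.
Unset Printing Implicit Defensive.

Import Order.TTheory GRing.Theory Num.Theory.
Import numFieldNormedType.Exports.

Local Open Scope classical_set_scope.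
Local Open Scope ring_scope.

(* Points of R^n are column vectors, so that matrix formulas read as in the
   mathematics.  The library topology of 'cV[R]_n comes from the maximum norm,
   which is equivalent to the Euclidean norm: openness, closedness, limits,
   differentiability and local Lipschitz continuity are the usual ones.  Every
   quantitative estimate uses l2norm / opnorm. *)

Section Euclidean.
Variable R : realType.

Definition inner n (u v : 'cV[R]_n) : R := \sum_(i < n) u i 0 * v i 0.

Definition l2norm n (u : 'cV[R]_n) : R := Num.sqrt (inner u u).

Definition opnorm m n (M : 'M[R]_(m, n)) : R :=
  sup [set l2norm (M *m u) | u in [set u : 'cV[R]_n | l2norm u <= 1]].

Definition cball n (x : 'cV[R]_n) (e : R) : set 'cV[R]_n :=
  [set y | l2norm (y - x) <= e].

Definition dist n (x : 'cV[R]_n) (S : set 'cV[R]_n) : R :=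
  inf [set l2norm (x - y) | y in S].

(* Square roots of the eigenvalues of M^T M, counted with multiplicity, in
   decreasing order (rootsR lists each real root once). *)
Definition singular_values m n (M : 'M[R]_(m, n)) : seq R :=
  let q := char_poly (M^T *m M) in
  sort >=%O (map Num.sqrt (flatten [seq nseq (mup a q) a | a <- rootsR q])).

(* The r-th largest singular value, counted from r = 1. *)
Definition sigma m n (r : nat) (M : 'M[R]_(m, n)) : R :=
  (singular_values M)`_r.-1.

Definition has_dim n (S : set 'cV[R]_n) (k : nat) : Prop :=
  exists2 V : {vspace 'cV[R]_n}, S = [set u | u \in V] & \dim V = k.

Definition orthproj n (S : set 'cV[R]_n) : 'M[R]_n :=
  xget 0 [set P | [/\ P^T = P, P *m P = P & forall d, S d <-> P *m d = d]].

End Euclidean.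

Section ConvexGeometry.
Variables (R : realType) (n : nat).
Implicit Types (X : set 'cV[R]_n) (x y d v : 'cV[R]_n).

Definition aff X : set 'cV[R]_n :=
  [set y | exists k (a : 'I_k -> R) (z : 'I_k -> 'cV[R]_n),
     [/\ forall i, X (z i), \sum_(i < k) a i = 1
       & y = \sum_(i < k) a i *: z i]].

(* The direction aff(X) - x; it does not depend on the choice of x in X. *)
Definition affdir X : set 'cV[R]_n :=
  [set d | exists2 x, X x & aff X (x + d)].

Definition tangent_cone X x : set 'cV[R]_n :=
  [set d | exists (y : nat -> 'cV[R]_n) (t : nat -> R),
     [/\ forall k, X (y k) /\ 0 < t k,
         y @ \oo --> x, t @ \oo --> (0 : R)
       & (fun k => (t k)^-1 *: (y k - x)) @ \oo --> d]].

Definition normal_cone X x : set 'cV[R]_n :=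
  [set v | forall y, X y -> inner v (y - x) <= 0].

Definition tangent_lineality X x : set 'cV[R]_n :=
  [set d | tangent_cone X x d /\ tangent_cone X x (- d)].

End ConvexGeometry.

Section Gradients.
Variables (R : realType) (n : nat).

Definition gradient (f : 'cV[R]_n -> R) (x : 'cV[R]_n) : 'cV[R]_n :=
  \col_i 'd f x (delta_mx i 0).

(* Transposed Jacobian: column j is the gradient of the j-th component. *)
Definition grad p (c : 'cV[R]_n -> 'cV[R]_p) (x : 'cV[R]_n) : 'M[R]_(n, p) :=
  \matrix_(i, j) ('d c x (delta_mx i 0) : 'cV[R]_p) j 0.

(* F is continuously differentiable over D with gradient G, and G is locally
   Lipschitz over D ([locally _] ranges over all points of D `*` D; away from
   the diagonal it only asks for local boundedness of G).  F is total and differentiability at the points of D is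
   that of F itself: when D is not open, the values of F outside D are those of
   the extension through which the derivative is understood. *)
Definition lipschitz_smooth (V W : normedModType R) (D : set 'cV[R]_n)
    (F : 'cV[R]_n -> V) (G : 'cV[R]_n -> W) : Prop :=
  [/\ forall x, D x -> differentiable F x,
      {within D, continuous G}
    & [locally [lipschitz G x | x in D]]].

End Gradients.

Section Problem.
Variables (R : realType) (n p : nat).
Variables (X Y : set 'cV[R]_n) (f : 'cV[R]_n -> R) (c : 'cV[R]_n -> 'cV[R]_p).
Implicit Types (x y : 'cV[R]_n) (r : nat).

(* Only the values of c on Y are meaningful. *)
Definition ncp_setting : Prop :=
  [/\ closed X, convex_set X, open Y & X `<=` Y].

Definition feasible : set 'cV[R]_n := [set x | X x /\ c x = 0].

Definition rank_condition r x (tau : R) : Prop :=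
  (forall y, Y y -> aff X y -> cball x tau y ->
     has_dim [set (grad c y)^T *m d | d in affdir X] r) /\
  (forall y, X y -> cball x tau y ->
     has_dim [set (grad c y)^T *m d | d in tangent_lineality X y] r).

Definition regular_data r : Prop :=
  [/\ lipschitz_smooth setT f (gradient f),
      lipschitz_smooth Y c (grad c),
      (0 < r)%N
    & forall x, feasible x -> exists2 tau : R, 0 < tau & rank_condition r x tau].

Definition ncp_stationary x : Prop :=
  feasible x /\
  exists (lambda : 'cV[R]_p) (v : 'cV[R]_n),
    normal_cone X x v /\ 0 = gradient f x + grad c x *m lambda + v.

Section Dissolving.
Variables (A : 'cV[R]_n -> 'cV[R]_n) (RA : 'cV[R]_n -> 'M[R]_n).

Definition normal_condition x (omega : R) : Prop :=
  forall y, X y -> cball x omega y ->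
    forall v, normal_cone X y v -> (grad A y - 1%:M - RA y) *m v = 0.

Definition constraint_dissolving : Prop :=
  [/\ lipschitz_smooth X A (grad A),
      forall x, feasible x -> A x = x /\ grad A x *m grad c x = 0,
      [locally [lipschitz RA x | x in X]],
      forall x, feasible x -> RA x = 0
    & forall x, feasible x -> exists2 omega : R, 0 < omega & normal_condition x omega].

Definition cdp_obj (beta : R) (x : 'cV[R]_n) : R :=
  f (A x) + beta / 2 * l2norm (c x) ^+ 2.

Definition cdp_stationary (beta : R) x : Prop :=
  X x /\ exists2 v, normal_cone X x v & 0 = gradient (cdp_obj beta) x + v.

End Dissolving.

Definition PE : 'M[R]_n := orthproj (affdir X).

(* For feasible x this is also the constant sigma_{x,c}. *)
Definition pi_ r x : R := sigma r (PE *m grad c x).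

Definition manifold (Yt : set 'cV[R]_n) : set 'cV[R]_n :=
  [set y | [/\ Yt y, aff X y & c y = 0]].

(* "Constant near x" is understood, as in rank_condition, for the points of the
   affine hull. *)
Definition constant_rank_nbhd (Yt : set 'cV[R]_n) : Prop :=
  [/\ open Yt, X `<=` Yt, Yt `<=` Y
    & forall x, manifold Yt x -> exists2 e : R, 0 < e &
        exists k, forall y, Yt y -> aff X y -> cball x e y ->
          has_dim [set (grad c y)^T *m d | d in affdir X] k].

Definition error_bound_condition (Yt : set 'cV[R]_n) r x (kappa : R) : Prop :=
  forall y, Y y -> aff X y -> cball x kappa y ->
    dist y (manifold Yt) <= 2 / pi_ r x * l2norm (c y) /\
    l2norm (PE *m grad c y *m c y) >= pi_ r x / 2 * l2norm (c y).

Definition radii r x (m : R) : set R :=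
  [set rho | 0 < rho <= m /\
             inf [set pi_ r y | y in X `&` cball x rho] >= pi_ r x / 2].

Definition is_largest (S : set R) (rho : R) : Prop := S rho /\ ubound S rho.

(* The constants are suprema of nonnegative quantities.  They are taken in the
   extended reals, with 0 added so that an empty supremum is 0; there
   0^-1 = +oo, so that a vanishing denominator imposes no bound on delta. *)
Definition nnsup (T : Type) (D : set T) (g : T -> R) : \bar R :=
  ereal_sup ((0 : \bar R)%E |` [set (g y)%:E | y in D]).

Section Constants.
Variables (A : 'cV[R]_n -> 'cV[R]_n) (RA : 'cV[R]_n -> 'M[R]_n).
Variables (r : nat) (x : 'cV[R]_n) (rho : R).

Definition Theta : set 'cV[R]_n := X `&` cball x rho.
Definition Theta_infeasible : set 'cV[R]_n := Theta `&` [set y | c y != 0].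

Definition M_f : \bar R := nnsup Theta (fun y => l2norm (gradient f (A y))).
Definition M_c : \bar R := nnsup Theta (fun y => opnorm (grad c y)).
Definition M_A : \bar R := nnsup Theta (fun y => opnorm (grad A y)).
Definition M_R : \bar R :=
  nnsup Theta_infeasible (fun y => opnorm (RA y) / l2norm (c y)).
Definition M_I : \bar R :=
  nnsup Theta_infeasible
    (fun y => opnorm (PE *m grad A y *m (grad A y - 1%:M)) / l2norm (c y)).
Definition M_B : \bar R :=
  nnsup Theta_infeasible
    (fun y => opnorm (grad A y *m grad c y) / l2norm (c y)).
Definition L_A : \bar R :=
  nnsup [set yz : 'cV[R]_n * 'cV[R]_n | [/\ Theta yz.1, Theta yz.2 & yz.1 != yz.2]]
    (fun yz => opnorm (grad A yz.1 - grad A yz.2) / l2norm (yz.1 - yz.2)).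

Local Open Scope ereal_scope.

Definition delta : \bar R :=
  mine rho%:E
    (mine ((pi_ r x)%:E / (8%:E * (M_R * M_c + M_B) * M_c)) (M_c)^-1).

Definition Omega : set 'cV[R]_n :=
  [set y | X y /\ (l2norm (y - x))%:E <= delta].

Definition beta_min : \bar R :=
  maxe (8%:E * M_f * (M_I + M_R * M_A) / (pi_ r x)%:E)
       (M_f * L_A * (1 + M_A + M_A * M_A) / (pi_ r x ^+ 2)%:E).

End Constants.
End Problem.

(* Main.v *)
From HB Require Import structures.
Require Import Defs.
From mathcomp Require Import all_boot all_order all_algebra.
From mathcomp Require Import all_classical all_reals all_analysis.
From mathcomp Require Import ring lra.

Set Implicit Arguments.
Unset Strict Implicit.
Unset Printing Implicit Defensive.

Import Order.TTheory GRing.Theory Num.Theory.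
Import numFieldNormedType.Exports.

Local Open Scope classical_set_scope.
Local Open Scope ring_scope.

(** Write [J], [C] and [Q] for the values at [y] of [grad A], [grad c] and [RA],
    and [h] for the penalty function [cdp_obj f c A beta].

    The inequality.  If [v] is normal to [X] at [y], the matrix [J - 1 - Q] kills
    [v].  Apply it, followed by the projection [PE X], to the vector
    [gradient h y + v], whose norm is to be bounded below: [v] disappears, and
    the main remaining term is [beta] times the projection of [C (c y)], which
    the error bound makes at least [beta * pi_ / 2 * l2norm (c y)].  The other
    terms are proportional to [l2norm (c y)] or to its square; the lower bound
    on [beta] and the radius [delta] make them small in comparison
    ([penalty_estimate]).  The square is where [delta] enters, through the mean
    value inequality [l2norm (c y) <= M_c * l2norm (y - x)].  The constants are
    used only as upper bounds of the corresponding quantities at [y], and an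
    infinite constant in the denominators of [delta] forces [y = x]
    ([Omega_constants]).

    Feasibility.  At a stationary point of the penalty problem
    [gradient h y + v = 0] for some normal [v], so the inequality gives
    [c y = 0] when [pi_] is positive.  When [pi_] is zero the error bound says
    that the distance from [y] to the zero set of [c] is at most zero, and again
    [c y = 0] ([cdp_stationary_feasible]).

    Stationarity.  Now [y] is feasible, so [J C = 0], [J] fixes the normal
    vectors at [y], and stationarity reads [J (gradient f y + v) = 0].  It
    remains to see that the kernel of [J] is the range of [C]
    ([kernel_range]).  This holds if [J^T], the derivative of [A], fixes every
    direction [d] that is orthogonal to the normal vectors and to the range of
    [C].  Since [A] is the identity on the feasible set, it is enough that [d]
    be tangent to the feasible set ([diff_fixed_direction],
    [feasible_tangent]).

    Tangency is a theorem of Lyusternik and Robinson type.  By polarity [d] is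
    a limit of feasible directions of the convex set [X]
    ([feasible_direction_polar]).  The rank conditions give [r] directions in the
    lineality space of the tangent cone, the columns of [B], and [r] linear
    combinations [T c] of the constraints whose derivatives along these
    directions form the identity matrix.  Minimizing [|T c| + e * |w - z|] over
    [w] in [X] corrects a point [z] of [X] to a zero of [T c] at distance
    [O(|T c z|)] ([metric_regularity]), and by constant rank the zeros of [T c]
    in the affine hull of [X] near [y] are zeros of [c]
    ([constant_rank_vanishing]).  Both steps are compactness arguments followed
    by a first-order comparison at the extremal point, which replaces the
    implicit function theorem. *)

(** * Euclidean norm and operator norm *)

Section Euclidean.
Variable R : realType.

Lemma inner_trmx n (u v : 'cV[R]_n) : inner u v = (u^T *m v) 0 0.
Proof. by rewrite mxE; apply: eq_bigr => i _; rewrite mxE. Qed.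

Lemma innerC n (u v : 'cV[R]_n) : inner u v = inner v u.
Proof. by apply: eq_bigr => i _; rewrite mulrC. Qed.

Lemma innerDr n (u v w : 'cV[R]_n) : inner u (v + w) = inner u v + inner u w.
Proof. by rewrite !inner_trmx mulmxDr mxE. Qed.

Lemma innerZr n a (u v : 'cV[R]_n) : inner u (a *: v) = a * inner u v.
Proof. by rewrite !inner_trmx -scalemxAr mxE. Qed.

Lemma innerNr n (u v : 'cV[R]_n) : inner u (- v) = - inner u v.
Proof. by rewrite -scaleN1r innerZr mulN1r. Qed.

Lemma innerBr n (u v w : 'cV[R]_n) : inner u (v - w) = inner u v - inner u w.
Proof. by rewrite innerDr innerNr. Qed.

Lemma innerDl n (u v w : 'cV[R]_n) : inner (u + v) w = inner u w + inner v w.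
Proof. by rewrite innerC innerDr !(innerC w). Qed.

Lemma innerZl n a (u v : 'cV[R]_n) : inner (a *: u) v = a * inner u v.
Proof. by rewrite innerC innerZr innerC. Qed.

Lemma innerNl n (u v : 'cV[R]_n) : inner (- u) v = - inner u v.
Proof. by rewrite innerC innerNr innerC. Qed.

Lemma innerBl n (u v w : 'cV[R]_n) : inner (u - v) w = inner u w - inner v w.
Proof. by rewrite innerDl innerNl. Qed.

Lemma inner0r n (u : 'cV[R]_n) : inner u 0 = 0.
Proof. by rewrite -(scale0r u) innerZr mul0r. Qed.

Lemma inner_mulmxl m n (M : 'M[R]_(m, n)) u v :
  inner (M *m u) v = inner u (M^T *m v).
Proof. by rewrite !inner_trmx trmx_mul mulmxA. Qed.

Lemma inner_ge0 n (u : 'cV[R]_n) : 0 <= inner u u.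
Proof. by apply: sumr_ge0 => i _; rewrite -expr2 sqr_ge0. Qed.

Lemma inner_eq0 n (u : 'cV[R]_n) : inner u u = 0 -> u = 0.
Proof.
move=> /eqP; rewrite psumr_eq0; last by move=> i _; rewrite -expr2 sqr_ge0.
move=> /allP u0; apply/matrixP => i j; rewrite mxE ord1.
by have := u0 i (mem_index_enum i); rewrite -expr2 sqrf_eq0 => /eqP.
Qed.

Lemma l2norm_ge0 n (u : 'cV[R]_n) : 0 <= l2norm u.
Proof. exact: sqrtr_ge0. Qed.

Lemma sqr_l2norm n (u : 'cV[R]_n) : l2norm u ^+ 2 = inner u u.
Proof. by rewrite sqr_sqrtr// inner_ge0. Qed.

Lemma l2norm0_eq0 n (u : 'cV[R]_n) : l2norm u = 0 -> u = 0.
Proof. by move=> u0; apply: inner_eq0; rewrite -sqr_l2norm u0 expr0n. Qed.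

Lemma l2norm0 n : l2norm (0 : 'cV[R]_n) = 0.
Proof. by rewrite /l2norm inner0r sqrtr0. Qed.

Lemma l2norm_gt0 n (u : 'cV[R]_n) : (0 < l2norm u) = (u != 0).
Proof.
rewrite lt_def l2norm_ge0 andbT; congr (~~ _).
by apply/eqP/eqP => [/l2norm0_eq0|->]; last exact: l2norm0.
Qed.

Lemma l2normZ n a (u : 'cV[R]_n) : l2norm (a *: u) = `|a| * l2norm u.
Proof.
by rewrite /l2norm innerZl innerZr mulrA -expr2 sqrtrM ?sqr_ge0// sqrtr_sqr.
Qed.

Lemma l2normN n (u : 'cV[R]_n) : l2norm (- u) = l2norm u.
Proof. by rewrite -scaleN1r l2normZ normrN1 mul1r. Qed.

Lemma inner_le n (u v : 'cV[R]_n) : inner u v <= l2norm u * l2norm v.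
Proof.
have [->|u0] := eqVneq u 0; first by rewrite innerC inner0r l2norm0 mul0r.
have [->|v0] := eqVneq v 0; first by rewrite inner0r l2norm0 mulr0.
(* This vector is zero exactly in the case of equality. *)
have := inner_ge0 (l2norm v *: u - l2norm u *: v).
rewrite innerBl !innerBr !innerZl !innerZr (innerC v u) -!sqr_l2norm.
move: u0 v0; rewrite -!l2norm_gt0 => u0 v0 H.
rewrite -subr_ge0 -(@pmulr_rge0 _ (2 * (l2norm u * l2norm v))) ?mulr_gt0//.
lra.
Qed.

Lemma normr_inner_le n (u v : 'cV[R]_n) : `|inner u v| <= l2norm u * l2norm v.
Proof.
rewrite ler_norml inner_le andbT lerNl -innerNl.
by rewrite -(l2normN u) inner_le.
Qed.

Lemma l2normD n (u v : 'cV[R]_n) : l2norm (u + v) <= l2norm u + l2norm v.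
Proof.
rewrite -(@ler_pXn2r _ 2)// ?nnegrE ?addr_ge0 ?l2norm_ge0// sqrrD !sqr_l2norm.
by rewrite innerDl !innerDr (innerC v u); have := inner_le u v; lra.
Qed.

Lemma l2normB n (u v : 'cV[R]_n) : l2norm (u - v) <= l2norm u + l2norm v.
Proof. by rewrite -(l2normN v) l2normD. Qed.

Lemma coord_le_l2norm n (u : 'cV[R]_n) i : `|u i 0| <= l2norm u.
Proof.
rewrite -sqrtr_sqr ler_sqrt ?inner_ge0// /inner (bigD1 i)//= expr2 lerDl.
by apply: sumr_ge0 => j _; rewrite -expr2 sqr_ge0.
Qed.

Lemma coord_le_norm m n (M : 'M[R]_(m, n)) i j : `|M i j| <= `|M|.
Proof.
rewrite [leRHS]/Num.norm /= mx_normrE; apply/bigmax_geP; right => /=.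
by exists (i, j).
Qed.

Lemma norm_le_coord m n (M : 'M[R]_(m, n)) b :
  0 <= b -> (forall i j, `|M i j| <= b) -> `|M| <= b.
Proof.
move=> b0 Mb; rewrite [leLHS]/Num.norm /= mx_normrE; apply/bigmax_leP.
by split=> // -[i j] _; exact: Mb.
Qed.

Lemma norm_le_l2norm n (u : 'cV[R]_n) : `|u| <= l2norm u.
Proof.
apply: norm_le_coord => [|i j]; first exact: l2norm_ge0.
by rewrite ord1 coord_le_l2norm.
Qed.

Lemma l2norm_le_norm n (u : 'cV[R]_n) : l2norm u <= n%:R * `|u|.
Proof.
have h : 0 <= n%:R * `|u| by rewrite mulr_ge0.
rewrite -(ger0_norm h) -sqrtr_sqr ler_sqrt ?sqr_ge0//.
apply: (@le_trans _ _ (\sum_(i < n) `|u| ^+ 2)).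
  apply: ler_sum => i _; rewrite -expr2 -real_normK ?num_real//.
  by rewrite ler_pXn2r ?nnegrE// coord_le_norm.
rewrite sumr_const card_ord -[leLHS]mulr_natl exprMn ler_wpM2r ?sqr_ge0//.
by case: n {u h} => [|n]; rewrite ?expr0n// ler_eXnr// ler1n.
Qed.

Lemma norm_mulmx m n k (M : 'M[R]_(m, n)) (N : 'M[R]_(n, k)) :
  `|M *m N| <= n%:R * `|M| * `|N|.
Proof.
apply: norm_le_coord => [|i j]; first by rewrite !mulr_ge0.
rewrite mxE (le_trans (ler_norm_sum _ _ _))//.
apply: (@le_trans _ _ (\sum_(l < n) `|M| * `|N|)).
  by apply: ler_sum => l _; rewrite normrM ler_pM ?coord_le_norm.
by rewrite sumr_const card_ord -mulrA mulr_natl.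
Qed.

Lemma opnorm_has_sup m n (M : 'M[R]_(m, n)) :
  has_sup [set l2norm (M *m u) | u in [set u : 'cV[R]_n | l2norm u <= 1]].
Proof.
split; first by exists (l2norm (M *m 0)), 0 => //=; rewrite l2norm0.
exists (m%:R * (n%:R * `|M|)) => _ [u /= u1 <-].
rewrite (le_trans (l2norm_le_norm _))// ler_wpM2l//.
rewrite (le_trans (norm_mulmx _ _))// ler_piMr// ?mulr_ge0//.
exact: le_trans (norm_le_l2norm _) u1.
Qed.

Lemma opnorm_ge0 m n (M : 'M[R]_(m, n)) : 0 <= opnorm M.
Proof.
apply: le_trans (l2norm_ge0 (M *m 0)) _.
apply: ub_le_sup; first by case: (opnorm_has_sup M).
by exists 0 => //=; rewrite l2norm0.
Qed.

Lemma l2norm_mulmx m n (M : 'M[R]_(m, n)) u :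
  l2norm (M *m u) <= opnorm M * l2norm u.
Proof.
have [->|u0] := eqVneq u 0; first by rewrite mulmx0 !l2norm0 mulr0.
have ugt0 : 0 < l2norm u by rewrite l2norm_gt0.
rewrite -ler_pdivrMr// mulrC.
have h : 0 <= (l2norm u)^-1 by rewrite invr_ge0 ltW.
rewrite -[X in X * _](ger0_norm h) -l2normZ scalemxAr.
apply: ub_le_sup; first by case: (opnorm_has_sup M).
exists ((l2norm u)^-1 *: u) => //=.
by rewrite l2normZ ger0_norm// mulVf// gt_eqF.
Qed.

(** [orthproj] falls back to the zero matrix when [S] admits no orthogonal
    projection, so it never increases the norm. *)
Lemma l2norm_orthproj n (S : set 'cV[R]_n) u :
  l2norm (orthproj S *m u) <= l2norm u.
Proof.
rewrite /orthproj; case: xgetP => [P _ [PT PP _]|_]; last first.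
  by rewrite mul0mx l2norm0 l2norm_ge0.
have [->|] := eqVneq (P *m u) 0; first by rewrite l2norm0 l2norm_ge0.
rewrite -l2norm_gt0 => Pu0; rewrite -(ler_pM2l Pu0) -expr2 sqr_l2norm.
by rewrite inner_mulmxl PT mulmxA PP innerC inner_le.
Qed.

End Euclidean.

(** * Gradients and the mean value inequality *)

Section Derivatives.
Variable R : realType.

Lemma diff_eps (V W : normedModType R) (F : V -> W) (x : V) (e : R) :
  differentiable F x -> 0 < e ->
  \forall h \near 0, `|F (x + h) - F x - 'd F x h| <= e * `|h|.
Proof.
move=> dF e0; have [_] := (diff_locallyP x F).1 dF.
move=> /eqaddoP /(_ e e0); apply: filterS => h /=.
by rewrite (addrC x) -[in X in _ -> X]addrA -opprD.
Qed.

Lemma linear_bound_continuous (V W : normedModType R) (f : {linear V -> W}) k :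
  (forall u, `|f u| <= k * `|u|) -> continuous f.
Proof.
move=> fk; apply: bounded_linear_continuous.
exists `|k|; split; first exact: num_real.
move=> M kM; near=> u; apply: le_trans (fk u) _.
have u1 : `|u| <= 1 by near: u; exact: nbhs0_le.
apply: le_trans (ler_wpM2r (normr_ge0 u) (ler_norm k)) _.
by rewrite (le_trans (ler_piMr _ u1))// ltW.
Unshelve. all: by end_near. Qed.

Lemma inner_is_linear n (u : 'cV[R]_n) : linear (inner u).
Proof. by move=> a v w; rewrite innerDr innerZr. Qed.

HB.instance Definition _ n (u : 'cV[R]_n) :=
  GRing.isLinear.Build R 'cV[R]_n R _ (inner u) (inner_is_linear u).

Lemma normr_inner_norm n (u v : 'cV[R]_n) :
  `|inner u v| <= l2norm u * n%:R * `|v|.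
Proof.
rewrite (le_trans (normr_inner_le _ _))// -mulrA.
by rewrite ler_wpM2l ?l2norm_ge0 ?l2norm_le_norm.
Qed.

Lemma inner_continuous n (u : 'cV[R]_n) : continuous (inner u).
Proof. exact: linear_bound_continuous (normr_inner_norm u). Qed.

Lemma diff_sqnorm n (u : 'cV[R]_n) :
  is_diff u (fun v : 'cV[R]_n => inner v v) (fun h => 2 * inner u h).
Proof.
have dfc : continuous (inner (2 *: u)) by exact: inner_continuous.
have E : (fun v : 'cV[R]_n => inner v v) \o shift u =
    cst (inner u u) + inner (2 *: u) +o_ (0 : 'cV[R]_n) id.
  apply/eqaddoP => e e0; near=> h; rewrite /cst /= !fctE.
  have -> : inner (h + u) (h + u) - (inner u u + inner (2 *: u) h) = inner h h.
    by rewrite innerDl !innerDr innerZl (innerC h u); lra.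
  apply: le_trans (normr_inner_norm _ _) _; rewrite ler_wpM2r//.
  apply: le_trans (ler_wpM2r _ (l2norm_le_norm h)) _; first exact: ler0n.
  rewrite mulrAC -natrM.
  apply: (@le_trans _ _ ((n * n).+1%:R * `|h|)).
    by rewrite ler_wpM2r// ler_nat.
  rewrite -ler_pdivlMl ?ltr0n// mulrC ltW//.
  by near: h; apply: (@nbhs0_lt _ 'cV[R]_n); rewrite divr_gt0 ?ltr0n.
apply: DiffDef; first by apply/diff_locallyP; rewrite (diff_unique dfc E).
by rewrite (diff_unique dfc E); apply/funext => h; rewrite /= innerZl.
Unshelve. all: by end_near. Qed.

Lemma col_delta n (d : 'cV[R]_n) : d = \sum_i d i 0 *: delta_mx i 0.
Proof.
rewrite [LHS]matrix_sum_delta; apply: eq_bigr => i _.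
by rewrite big_ord_recl big_ord0 addr0.
Qed.

Lemma diff_grad n p (c : 'cV[R]_n -> 'cV[R]_p) x d :
  'd c x d = (grad c x)^T *m d.
Proof.
rewrite [in LHS](col_delta d) linear_sum; apply/matrixP => i j.
rewrite ord1 summxE mxE; apply: eq_bigr => k _.
by rewrite linearZ /= !mxE mulrC.
Qed.

Lemma diff_gradient n (f : 'cV[R]_n -> R) x d :
  'd f x d = inner (gradient f x) d.
Proof.
rewrite [in LHS](col_delta d) linear_sum; apply: eq_bigr => k _.
by rewrite linearZ /= !mxE mulrC.
Qed.

Lemma inner_ext n (u v : 'cV[R]_n) : (forall d, inner u d = inner v d) -> u = v.
Proof.
move=> uv; apply/eqP; rewrite -subr_eq0; apply/eqP/inner_eq0.
by rewrite innerBl uv subrr.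
Qed.

Lemma gradient_cdp_obj n p (f : 'cV[R]_n -> R) (c : 'cV[R]_n -> 'cV[R]_p)
    (A : 'cV[R]_n -> 'cV[R]_n) beta y :
  differentiable A y -> differentiable f (A y) -> differentiable c y ->
  gradient (cdp_obj f c A beta) y =
    grad A y *m gradient f (A y) + beta *: (grad c y *m c y).
Proof.
move=> dA df dc; apply: inner_ext => d; rewrite -diff_gradient.
have -> : cdp_obj f c A beta =
    f \o A + beta / 2 *: ((fun v => inner v v) \o c).
  by apply/funext => z; rewrite /cdp_obj sqr_l2norm.
have [] := diff_sqnorm (c y); set q := fun v : 'cV[R]_p => inner v v => dq dqE.
have dqc : differentiable (q \o c) y.
  exact: differentiable_comp.
have dfA : differentiable (f \o A) y by exact: differentiable_comp.
have E1 : 'd (f \o A) y d = inner (grad A y *m gradient f (A y)) d.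
  by rewrite diff_comp//= diff_gradient diff_grad inner_mulmxl.
have E2 : 'd (q \o c) y d = 2 * inner (grad c y *m c y) d.
  by rewrite diff_comp//= dqE diff_grad inner_mulmxl.
have E3 : 'd (beta / 2 *: (q \o c)) y d = beta / 2 * 'd (q \o c) y d.
  by have /(congr1 (@^~ d)) := diffZ (beta / 2) dqc.
have E4 : 'd (f \o A + beta / 2 *: (q \o c)) y d =
    'd (f \o A) y d + 'd (beta / 2 *: (q \o c)) y d.
  by have /(congr1 (@^~ d)) := diffD dfA (differentiableZ (beta / 2) dqc).
by rewrite E4 E3 E1 E2 innerDl innerZl mulrA divfK.
Qed.

(** Mean value inequality along a segment, tested against the increment
    [c y - c x] itself so that only a scalar mean value theorem is used. *)
Lemma l2norm_sub_le n p (c : 'cV[R]_n -> 'cV[R]_p) x y k :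
  (forall t, 0 <= t <= 1 -> differentiable c (x + t *: (y - x)) /\
      opnorm (grad c (x + t *: (y - x))) <= k) ->
  l2norm (c y - c x) <= k * l2norm (y - x).
Proof.
move=> H; set u := c y - c x; set d := y - x.
pose l (t : R) := x + t *: d.
have dl (t : R) : is_diff (t : R) l (fun h => h *: d).
  have H1 : is_diff (t : R) (cst x) (0 : R -> 'cV[R]_n) by exact: is_diff_cst.
  have H2 : is_diff (t : R) ( *:%R^~ d) ( *:%R^~ d) by exact: is_diff_scalel.
  exact: (is_diff_eq (is_diffD H1 H2) (add0r _)).
have dl1 (t : R) : differentiable l t by case: (dl t).
have dl2 (t : R) : 'd l t 1 = d by case: (dl t) => _ ->; rewrite scale1r.
pose phi : R -> R := inner u \o (c \o l).
have di z : differentiable (inner u) z.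
  exact/linear_differentiable/inner_continuous.
have dcl (t : R) : 0 <= t <= 1 -> differentiable (c \o l) t.
  by move=> /H[dc _]; apply: differentiable_comp.
have dphi (t : R) : 0 <= t <= 1 -> differentiable phi t.
  by move=> /dcl dc; apply: differentiable_comp.
have dphiE (t : R) :
    0 <= t <= 1 -> is_derive t 1 phi (inner (grad c (l t) *m u) d).
  move=> t01; apply: DeriveDef; first exact/diff_derivable/dphi.
  rewrite deriveE; last exact: dphi.
  rewrite /phi diff_comp//; last exact: dcl.
  rewrite /= diff_lin; last exact: inner_continuous.
  rewrite /= diff_comp//; last by case: (H t t01).
  by rewrite /= dl2 diff_grad inner_mulmxl.
have cphi : {within `[0, 1], continuous phi}.
  apply: derivable_within_continuous => t; rewrite in_itv/= => t01.
  exact/diff_derivable/dphi.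
have oc (t : R) : t \in `]0, 1[ -> 0 <= t <= 1.
  by rewrite in_itv/= => /andP[t0 t1]; rewrite !ltW.
have [t /oc t01] := @MVT R phi (fun t => inner (grad c (l t) *m u) d) 0 1 ltr01
  (fun t h => dphiE t (oc t h)) cphi.
have Ey : x + d = y by rewrite addrC subrK.
rewrite /phi /= /l scale0r addr0 scale1r Ey -innerBr subr0 mulr1.
rewrite -sqr_l2norm => E; have [u0|u0] := eqVneq u 0.
  rewrite u0 l2norm0 mulr_ge0 ?l2norm_ge0//.
  by have [_] := H t t01; apply: le_trans; exact: opnorm_ge0.
have ugt0 : 0 < l2norm u by rewrite l2norm_gt0.
rewrite -(ler_pM2l ugt0) -expr2 E (le_trans (inner_le _ _))//.
rewrite mulrA ler_wpM2r ?l2norm_ge0// (le_trans (l2norm_mulmx _ _))// mulrC.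
by rewrite ler_wpM2l ?l2norm_ge0//; case: (H t t01).
Qed.

End Derivatives.

(** * Lower bound on the gradient of the penalty function *)

Section Penalty.
Variable R : realType.

(** The matrix [J - 1 - Q] annihilates the normal vector [v], so it turns
    [J g + beta C z + v] into an expression free of [v]; projecting by [P]
    leaves the term [- beta P C z], of size at least [s beta / 2 * l2norm z],
    and terms that the two last hypotheses bound by a quarter of it each. *)
Lemma penalty_estimate n p (P J Q : 'M[R]_n) (C : 'M[R]_(n, p))
    (g v : 'cV[R]_n) (z : 'cV[R]_p) (s beta : R) :
  let q := opnorm Q / l2norm z in
  (forall u, l2norm (P *m u) <= l2norm u) ->
  0 <= s -> 0 <= beta -> 0 < l2norm z <= 1 ->
  (J - 1%:M - Q) *m v = 0 ->
  s / 2 * l2norm z <= l2norm (P *m C *m z) ->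
  8 * l2norm g * (opnorm (P *m J *m (J - 1%:M)) / l2norm z + q * opnorm J)
    <= s * beta ->
  8 * (q * opnorm C + opnorm (J *m C) / l2norm z) * l2norm z <= s ->
  s * beta * l2norm z <= 8 * (opnorm J + q + 1) *
    l2norm (J *m g + beta *: (C *m z) + v).
Proof.
set t := l2norm z => q P1 s0 beta0 /andP[t0 t1] Nv PCz Hg Hz.
set w := _ + v; set a := opnorm J in Hg *; set b := opnorm C in Hz.
set i := opnorm _ / t in Hg; set bc := opnorm (J *m C) / t in Hz.
have qE : opnorm Q = q * t by rewrite /q divfK ?gt_eqF.
have a0 : 0 <= a by exact: opnorm_ge0.
have b0 : 0 <= b by exact: opnorm_ge0.
have q0 : 0 <= q by rewrite divr_ge0 ?opnorm_ge0// ltW.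
have Ew : beta *: (P *m C *m z) =
    P *m J *m (J - 1%:M) *m g - P *m (Q *m (J *m g))
    + beta *: (P *m (J *m C *m z)) - beta *: (P *m (Q *m (C *m z)))
    - P *m ((J - 1%:M - Q) *m w).
  rewrite [(_ - Q) *m w]mulmxDr Nv addr0.
  rewrite !(mulmxDl, mulmxDr, mulNmx, mulmxN, mul1mx, mulmx1) -!scalemxAr.
  rewrite !mulmxA; apply/matrixP => k l; rewrite !mxE; lra.
have N1 : l2norm ((J - 1%:M - Q) *m w) <= (a + 1 + q) * l2norm w.
  rewrite 2!mulmxDl !mulNmx mul1mx.
  rewrite (le_trans (l2normB _ _))// (le_trans (lerD (l2normB _ _) (lexx _)))//.
  rewrite !mulrDl mul1r !lerD ?l2norm_mulmx//.
  rewrite (le_trans (l2norm_mulmx _ _))// ler_wpM2r ?l2norm_ge0// qE.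
  by rewrite ler_piMr.
have N2 : l2norm (P *m J *m (J - 1%:M) *m g) <= i * t * l2norm g.
  by rewrite (le_trans (l2norm_mulmx _ _))// /i divfK ?gt_eqF.
have N3 : l2norm (P *m (Q *m (J *m g))) <= q * t * (a * l2norm g).
  rewrite (le_trans (P1 _))// (le_trans (l2norm_mulmx _ _))// qE.
  by rewrite ler_wpM2l ?l2norm_mulmx// mulr_ge0// ltW.
have N4 : l2norm (P *m (J *m C *m z)) <= bc * t * t.
  rewrite (le_trans (P1 _))// (le_trans (l2norm_mulmx _ _))//.
  by rewrite /bc divfK ?gt_eqF.
have N5 : l2norm (P *m (Q *m (C *m z))) <= q * t * (b * t).
  rewrite (le_trans (P1 _))// (le_trans (l2norm_mulmx _ _))// qE.
  by rewrite ler_wpM2l ?l2norm_mulmx// mulr_ge0// ltW.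
have T : beta * l2norm (P *m C *m z) <=
    i * t * l2norm g + q * t * (a * l2norm g) + beta * (bc * t * t)
    + beta * (q * t * (b * t)) + (a + 1 + q) * l2norm w.
  rewrite -{1}(ger0_norm beta0) -l2normZ Ew.
  apply: le_trans (l2normB _ _) (lerD _ _); last exact: le_trans (P1 _) N1.
  apply: le_trans (l2normB _ _) (lerD _ _); last first.
    by rewrite l2normZ ger0_norm// ler_wpM2l.
  apply: le_trans (l2normD _ _) (lerD _ _); last first.
    by rewrite l2normZ ger0_norm// ler_wpM2l.
  exact: le_trans (l2normB _ _) (lerD N2 N3).
have H1 : beta * (s / 2 * t) <= beta * l2norm (P *m C *m z) by rewrite ler_wpM2l.
have H2 : 8 * l2norm g * (i + q * a) * t <= s * beta * t.
  by rewrite ler_wpM2r// ltW.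
have H3 : beta * t * (8 * (q * b + bc) * t) <= beta * t * s.
  by rewrite ler_wpM2l// mulr_ge0// ltW.
have H4 : 0 <= (a + 1 + q) * l2norm w by rewrite mulr_ge0 ?l2norm_ge0 ?addr_ge0.
nra.
Qed.

End Penalty.

(** * Suprema, distances and the error bound *)

Section SupremaAndInfima.
Variable R : realType.
Local Open Scope ereal_scope.

Lemma nnsup_ge0 (T : Type) (D : set T) (g : T -> R) : 0 <= nnsup D g.
Proof. by apply: ereal_sup_ubound; left. Qed.

Lemma le_nnsup (T : Type) (D : set T) (g : T -> R) y :
  D y -> (g y)%:E <= nnsup D g.
Proof. by move=> Dy; apply: ereal_sup_ubound; right; exists y. Qed.

(** Division by zero gives [+oo] in the extended reals: when [k] is zero the
    bound is void and the conclusion holds trivially, while an infinite [k]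
    would force [t <= 0]. *)
Lemma le_div_ereal (s t : R) (k : \bar R) :
  (0 <= s)%R -> (0 < t)%R -> 0 <= k -> t%:E <= s%:E / k ->
  exists2 k' : R, k = k'%:E & (k' * t <= s)%R.
Proof.
move=> s0 t0; case: k => [k||]//; last first.
  by rewrite invey mule0 => _; rewrite leNgt lte_fin t0.
rewrite lee_fin le_eqVlt => /predU1P[<-|k0].
  by exists 0%R => //; rewrite mul0r.
rewrite inver gt_eqF// -EFinM lee_fin ler_pdivlMr// mulrC => h.
by exists k.
Qed.

Local Close Scope ereal_scope.

Lemma dist_lbound n (x : 'cV[R]_n) (S : set 'cV[R]_n) :
  has_lbound [set l2norm (x - y) | y in S].
Proof. by exists 0 => _ [y _ <-]; exact: l2norm_ge0. Qed.

Lemma dist_ge0 n (x : 'cV[R]_n) (S : set 'cV[R]_n) : 0 <= dist x S.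
Proof.
have [[y Sy]|S0] := pselect (S !=set0).
  apply: lb_le_inf; first by exists (l2norm (x - y)), y.
  by move=> t [z _ <-]; exact: l2norm_ge0.
rewrite /dist; suff -> : [set l2norm (x - y) | y in S] = set0 by rewrite inf0.
by apply/seteqP; split=> // t [y Sy _]; apply: S0; exists y.
Qed.

Lemma mem_aff n (X : set 'cV[R]_n) x : X x -> aff X x.
Proof.
move=> Xx; exists 1%N, (fun=> 1), (fun=> x); split=> //.
  by rewrite big_ord_recl big_ord0 addr0.
by rewrite big_ord_recl big_ord0 addr0 scale1r.
Qed.

Lemma dist_le0_adherent n (x : 'cV[R]_n) (S : set 'cV[R]_n) :
  S !=set0 -> dist x S <= 0 ->
  forall e, 0 < e -> exists2 y, S y & `|x - y| < e.
Proof.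
move=> [s Ss] d0 e e0.
have [_ [y Sy <-]] := @inf_adherent R [set l2norm (x - y) | y in S] e e0
  (conj (ex_intro _ _ (ex_intro2 _ _ s Ss erefl)) (dist_lbound x S)).
move=> H; exists y => //; apply: le_lt_trans (norm_le_l2norm _) _.
by apply: lt_le_trans H _; rewrite gerDr.
Qed.

Lemma sigma_ge0 m n r (M : 'M[R]_(m, n)) : 0 <= sigma r M.
Proof.
rewrite /sigma; set s := singular_values M.
have [h|h] := ltnP r.-1 (size s); last by rewrite nth_default.
have := mem_nth 0 h; rewrite mem_sort => /mapP[a _ ->]; exact: sqrtr_ge0.
Qed.

(** The vanishing of [c] follows from the error bound alone when [pi_] is zero,
    because the bound then reads [dist y (manifold) <= 0]. *)
Lemma pi_eq0_feasible n p (X Y Yt : set 'cV[R]_n) (c : 'cV[R]_n -> 'cV[R]_p)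
    r x y kappa :
  manifold X c Yt x -> {for y, continuous c} ->
  error_bound_condition X Y c Yt r x kappa -> pi_ X c r x = 0 ->
  Y y -> aff X y -> cball x kappa y -> c y = 0.
Proof.
move=> Mx cc EB pi0 Yy ay by_; have [+ _] := EB y Yy ay by_.
rewrite pi0 invr0 mulr0 mul0r => d0.
have adh := dist_le0_adherent (ex_intro _ x Mx) d0.
apply/eqP; rewrite -normr_le0; apply/ler_addgt0Pr => e e0; rewrite add0r.
have /nbhs_ballP[d /= dgt0 Hd] := cc _ (nbhsx_ballx (c y) e e0).
have [z [_ _ cz0] yz] := adh d dgt0.
have /Hd : ball y d z by rewrite -ball_normE.
by rewrite /preimage/= -ball_normE /= cz0 subr0; exact: ltW.
Qed.

End SupremaAndInfima.

(** * The inequality and the feasibility of stationary points *)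

Section Exactness.
Variables (R : realType) (n p : nat).
Implicit Types (X Y : set 'cV[R]_n).

Lemma convex_segment X x y t : convex_set X -> X x -> X y ->
  0 <= t <= 1 -> X (x + t *: (y - x)).
Proof.
move=> cX Xx Xy /andP[t0 t1].
rewrite (_ : x + t *: (y - x) = t *: y + (1 - t) *: x).
  exact: set_mem (cX y x (Itv01 t0 t1) (mem_set Xy) (mem_set Xx)).
by rewrite scalerBl scale1r scalerBr addrCA.
Qed.

Section Bound.
Variables (X Y Yt : set 'cV[R]_n) (f : 'cV[R]_n -> R).
Variables (c : 'cV[R]_n -> 'cV[R]_p) (A : 'cV[R]_n -> 'cV[R]_n).
Variables (RA : 'cV[R]_n -> 'M[R]_n) (r : nat) (x y : 'cV[R]_n).
Variables (omega kappa rho beta : R).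

Hypothesis cX : convex_set X.
Hypothesis XY : X `<=` Y.
Hypothesis df : forall z, differentiable f z.
Hypothesis dc : forall z, Y z -> differentiable c z.
Hypothesis dA : forall z, X z -> differentiable A z.
Hypothesis Kx : feasible X c x.
Hypothesis omegaP : normal_condition X A RA x omega.
Hypothesis kappaP : error_bound_condition X Y c Yt r x kappa.
Hypothesis rho_omega : rho <= omega.
Hypothesis rho_kappa : rho <= kappa.
Hypothesis Omega_y : Omega X c A RA r x rho y.
Hypothesis beta_ge0 : 0 <= beta.
Hypothesis beta_ge : (beta_min X f c A RA r x rho <= beta%:E)%E.

Let Xy : X y. Proof. by case: Omega_y. Qed.

Lemma Omega_cball : cball x rho y.
Proof.
have [_] := Omega_y; rewrite /delta le_min lee_fin => /andP[h _].
exact: h.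
Qed.

(** The radius [delta] vanishes as soon as one of the constants in its
    denominators is infinite, so away from the feasible set these constants are
    finite and the mean value inequality controls [c y] by [y - x]. *)
Lemma Omega_constants : c y != 0 ->
  exists2 k : R, (0 < k)%R /\ l2norm (c y) <= k * l2norm (y - x) &
   [/\ k * l2norm (y - x) <= 1, opnorm (grad c y) <= k &
   8 * (opnorm (RA y) / l2norm (c y) * opnorm (grad c y)
        + opnorm (grad A y *m grad c y) / l2norm (c y)) * l2norm (c y)
   <= pi_ X c r x].
Proof.
move=> cy0; have [Xx cx0] := Kx.
have xy : 0 < l2norm (y - x).
  rewrite l2norm_gt0 subr_eq0; apply: contraNneq cy0 => ->; exact/eqP.
have rho0 : 0 <= rho by apply: le_trans (ltW xy) Omega_cball.
have Th t : 0 <= t <= 1 -> Theta X x rho (x + t *: (y - x)).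
  move=> /[dup] t01 /andP[t0 t1]; split; first exact: convex_segment.
  rewrite /cball /= addrC addKr l2normZ ger0_norm//.
  by rewrite (le_trans _ Omega_cball)// ler_piMl// l2norm_ge0.
have Thy : Theta X x rho y by split=> //; exact: Omega_cball.
have Tiy : Theta_infeasible X c x rho y by [].
have [_] := Omega_y; rewrite /delta !le_min => /and3P[_ hd hM].
have [k Mk] : exists k : R, M_c X c x rho = k%:E.
  move: hM (nnsup_ge0 (Theta X x rho) (fun z => opnorm (grad c z))).
  rewrite -/(M_c X c x rho); case: (M_c X c x rho) => [k||]//; first by exists k.
  by rewrite invey leNgt lte_fin xy.
have kP z : Theta X x rho z -> opnorm (grad c z) <= k.
  by move=> Tz; rewrite -lee_fin -Mk; exact: le_nnsup.
have ck : l2norm (c y) <= k * l2norm (y - x).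
  rewrite -[c y]subr0 -cx0; apply: l2norm_sub_le => t t01.
  by split; [apply: dc; apply: XY; case: (Th t t01)|apply: kP; exact: Th].
have k0 : 0 < k.
  by rewrite -(pmulr_lgt0 _ xy) (lt_le_trans _ ck)// l2norm_gt0.
exists k => //; split; last 1 first.
- have [||K KE Kle] := le_div_ereal _ xy _ hd.
  + exact: sigma_ge0.
  + rewrite !mule_ge0 ?adde_ge0 ?mule_ge0 ?nnsup_ge0//.
  apply: le_trans Kle; set t := l2norm (c y) in ck *.
  set q := opnorm (RA y) / t; set b := opnorm (_ *m _) / t.
  have q0 : 0 <= q by rewrite divr_ge0 ?opnorm_ge0 ?l2norm_ge0.
  have b0 : 0 <= b by rewrite divr_ge0 ?opnorm_ge0 ?l2norm_ge0.
  have c0 : 0 <= opnorm (grad c y) by exact: opnorm_ge0.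
  have S0 : 0 <= q * opnorm (grad c y) + b.
    by apply: addr_ge0 => //; exact: mulr_ge0.
  have : 8 * (q * opnorm (grad c y) + b) * k <= K.
    rewrite -lee_fin -KE Mk EFinM.
    rewrite lee_pmul// ?lee_fin ?mulr_ge0 ?(ltW k0)//.
    rewrite EFinM lee_wpmul2l ?lee_fin// EFinD leeD ?le_nnsup//.
      rewrite EFinM lee_pmul ?lee_fin//; last exact: kP.
      exact: (le_nnsup (fun z => opnorm (RA z) / l2norm (c z))).
    exact: (le_nnsup (fun z => opnorm (grad A z *m grad c z) / l2norm (c z))).
  move=> hK; apply: le_trans (ler_wpM2r (ltW xy) hK).
  by rewrite -[leRHS]mulrA ler_wpM2l ?mulr_ge0.
- move: hM; rewrite Mk inver gt_eqF// lee_fin => hM.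
  by rewrite -ler_pdivlMl// mulr1.
- exact: kP.
Qed.

Lemma gradient_cdp_ge v : c y != 0 -> normal_cone X y v ->
  pi_ X c r x * beta * l2norm (c y) <=
  8 * (opnorm (grad A y) + opnorm (RA y) / l2norm (c y) + 1) *
    l2norm (gradient (cdp_obj f c A beta) y + v).
Proof.
move=> cy0 Nv; have [k [k0 ck] [k1 kc kpi]] := Omega_constants cy0.
have Thy : Theta X x rho y by split=> //; exact: Omega_cball.
have Tiy : Theta_infeasible X c x rho y by [].
have := sigma_ge0 r (PE X *m grad c x); rewrite -/(pi_ X c r x).
rewrite le_eqVlt => /predU1P[pi0|pi0].
  rewrite -pi0 !mul0r !mulr_ge0 ?l2norm_ge0//.
  by rewrite !addr_ge0 ?divr_ge0 ?opnorm_ge0 ?l2norm_ge0.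
rewrite gradient_cdp_obj; [|exact: dA|exact: df|exact/dc/XY].
apply: (penalty_estimate (P := PE X)) => //.
- exact: l2norm_orthproj.
- exact: ltW.
- by rewrite l2norm_gt0 cy0 (le_trans ck).
- apply: omegaP => //; exact: le_trans Omega_cball rho_omega.
- have [_] := kappaP (XY Xy) (mem_aff Xy) (le_trans Omega_cball rho_kappa).
  by [].
- move: beta_ge; rewrite /beta_min ge_max => /andP[+ _].
  rewrite inver gt_eqF// lee_pdivrMr// => H.
  rewrite -lee_fin [X in (_ <= X)%E]EFinM muleC; apply: le_trans H.
  have g0 z : 0 <= l2norm (gradient f (A z)) by exact: l2norm_ge0.
  have t0 : 0 <= l2norm (c y) by exact: l2norm_ge0.
  rewrite EFinM lee_pmul ?lee_fin ?mulr_ge0 ?addr_ge0 ?mulr_ge0 ?invr_ge0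
    ?opnorm_ge0//.
    rewrite EFinM lee_wpmul2l ?lee_fin//.
    exact: (le_nnsup (fun z => l2norm (gradient f (A z)))).
  rewrite EFinD leeD//.
    exact: (le_nnsup (fun z =>
      opnorm (PE X *m grad A z *m (grad A z - 1%:M)) / l2norm (c z))).
  rewrite EFinM lee_pmul ?lee_fin ?divr_ge0 ?opnorm_ge0//.
    exact: (le_nnsup (fun z => opnorm (RA z) / l2norm (c z))).
  exact: (le_nnsup (fun z => opnorm (grad A z))).
Qed.

Lemma dist_gradient_cdp_ge :
  ((pi_ X c r x * beta)%:E
     / (8%:E * (M_A X A x rho + M_R X c RA x rho + 1))
     * (l2norm (c y))%:E
   <= (dist 0 [set (gradient (cdp_obj f c A beta) y + v)%R
              | v in normal_cone X y])%:E)%E.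
Proof.
have [->|cy0] := eqVneq (c y) 0.
  by rewrite l2norm0 mule0 lee_fin dist_ge0.
have Thy : Theta X x rho y by split=> //; exact: Omega_cball.
have Tiy : Theta_infeasible X c x rho y by [].
set k := 8 * (opnorm (grad A y) + opnorm (RA y) / l2norm (c y) + 1).
have k0 : 0 < k.
  by rewrite mulr_gt0// ltr_wpDl// addr_ge0 ?divr_ge0 ?opnorm_ge0 ?l2norm_ge0.
have pi0 : 0 <= pi_ X c r x by exact: sigma_ge0.
apply: (@le_trans _ _ ((pi_ X c r x * beta / k * l2norm (c y))%:E)).
  rewrite [leRHS]EFinM lee_wpmul2r ?lee_fin ?l2norm_ge0//.
  rewrite [leRHS]EFinM lee_wpmul2l ?lee_fin ?mulr_ge0//.
  rewrite -[X in (_ <= X)%E]/((k^-1)%:E).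
  have -> : ((k^-1)%:E = (k%:E)^-1)%E by rewrite inver gt_eqF.
  rewrite lee_pV2 ?inE ?lee_fin ?(ltW k0)//; last first.
    by rewrite mule_ge0// !adde_ge0// nnsup_ge0.
  rewrite EFinM lee_wpmul2l// EFinD leeD// EFinD leeD//.
    exact: (le_nnsup (fun z => opnorm (grad A z))).
  exact: (le_nnsup (fun z => opnorm (RA z) / l2norm (c z))).
rewrite lee_fin; apply: lb_le_inf.
  exists (l2norm (0 - (gradient (cdp_obj f c A beta) y + 0))).
  exists (gradient (cdp_obj f c A beta) y + 0) => //.
  by exists 0 => // z _; rewrite innerC inner0r.
move=> _ [_ [v Nv <-] <-]; rewrite sub0r l2normN.
rewrite mulrAC ler_pdivrMr// mulrC [leRHS]mulrC mulrC.
exact: gradient_cdp_ge.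
Qed.

(** At a stationary point the residual [gradient + v] vanishes, which forces
    [c y = 0] unless [pi_] is zero; in that case the error bound does. *)
Lemma cdp_stationary_feasible : manifold X c Yt x -> 0 < beta ->
  cdp_stationary X f c A beta y -> c y = 0.
Proof.
move=> Mx b0 [_ [v Nv Ev]]; apply: contrapT => /eqP cy0.
have [pi0|pi0] := eqVneq (pi_ X c r x) 0.
  move: cy0; rewrite (pi_eq0_feasible Mx _ kappaP pi0)//.
  - by rewrite eqxx.
  - exact/differentiable_continuous/dc/XY.
  - exact: XY.
  - exact: mem_aff.
  - exact: le_trans Omega_cball rho_kappa.
have := gradient_cdp_ge cy0 Nv; rewrite -Ev l2norm0 mulr0 leNgt.
by rewrite !mulr_gt0// ?l2norm_gt0// lt_def pi0 sigma_ge0.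
Qed.

End Bound.
End Exactness.

(** * Column vectors in the maximum norm *)

Section ColumnSpaces.
Variable R : realType.

Lemma near_normP n (y : 'cV[R]_n) (P : 'cV[R]_n -> Prop) :
  (\forall w \near y, P w) <->
  exists2 e, 0 < e & forall w, `|w - y| <= e -> P w.
Proof.
split=> [/nbhs_ballP[e /= e0 H]|[e e0 H]].
  exists (e / 2) => [|w wy]; first by rewrite divr_gt0.
  apply: H; rewrite -ball_normE /= distrC (le_lt_trans wy)//.
  by rewrite ltr_pdivrMr// ltr_pMr// ltr1n.
apply/nbhs_ballP; exists e => //= w; rewrite -ball_normE /= distrC => /ltW.
exact: H.
Qed.

Lemma near0_line n (d : 'cV[R]_n) (P : 'cV[R]_n -> Prop) :
  (\forall u \near (0 : 'cV[R]_n), P u) ->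
  exists2 t, 0 < t & forall h, 0 <= h <= t -> P (h *: d).
Proof.
move=> /near_normP[e e0 H]; exists (e / (`|d| + 1)).
  by rewrite divr_gt0// ltr_wpDl.
move=> h /andP[h0 ht]; apply: H; rewrite subr0 normrZ ger0_norm//.
have d1 : 0 < `|d| + 1 by rewrite ltr_wpDl.
rewrite ler_pdivlMr// in ht; apply: le_trans ht.
by rewrite ler_wpM2l// lerDl.
Qed.

Lemma mulmx_sum_col m n (M : 'M[R]_(m, n)) (a : 'cV[R]_n) :
  M *m a = \sum_j a j 0 *: col j M.
Proof.
apply/matrixP => i k; rewrite ord1 !mxE summxE; apply: eq_bigr => j _.
by rewrite !mxE mulrC.
Qed.

Lemma mulmx_bound m n (M : 'M[R]_(m, n)) :
  exists2 b, 0 < b & forall u : 'cV[R]_n, `|M *m u| <= b * `|u|.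
Proof.
exists (n%:R * `|M| + 1) => [|u]; first by rewrite ltr_wpDl// mulr_ge0.
by rewrite (le_trans (norm_mulmx _ _))// ler_wpM2r// lerDl.
Qed.

Lemma near_mulmx m n k (D : 'cV[R]_k -> 'M[R]_(m, n)) y e :
  {for y, continuous D} -> 0 < e ->
  \forall w \near y, forall u : 'cV[R]_n, `|(D w - D y) *m u| <= e * `|u|.
Proof.
move=> cD e0; have e1 : 0 < e / n.+1%:R by rewrite divr_gt0.
have /cvgrPdist_le /(_ _ e1) := cD; apply: filterS => w Dw u.
rewrite (le_trans (norm_mulmx _ _))// ler_wpM2r// distrC.
apply: le_trans (ler_wpM2l (ler0n _ _) Dw) _.
rewrite mulrCA ler_piMr// ?(ltW e0)// ler_pdivrMr// mul1r ler_nat.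
exact: leqnSn.
Qed.

Lemma mulmxr_continuous m n k (M : 'M[R]_(m, n)) :
  continuous (fun u : 'M[R]_(n, k) => M *m u).
Proof. exact: (linear_bound_continuous (norm_mulmx M)). Qed.

Lemma norm_trmx m n (M : 'M[R]_(m, n)) : `|M^T| <= `|M|.
Proof. by apply: norm_le_coord => // i j; rewrite mxE coord_le_norm. Qed.

Lemma trmx_continuous m n : continuous (trmx : 'M[R]_(m, n) -> 'M[R]_(n, m)).
Proof.
by apply: (@linear_bound_continuous _ _ _ _ 1) => u; rewrite mul1r norm_trmx.
Qed.

Lemma sub_continuous n (y : 'cV[R]_n) : continuous (fun w : 'cV[R]_n => w - y).
Proof.
by move=> w; apply: (@continuousB _ _ _ id (cst y)) => //; exact: cst_continuous.
Qed.
Lemma norm_sub_continuous n (y : 'cV[R]_n) :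
  continuous (fun w : 'cV[R]_n => `|w - y|).
Proof.
move=> w; apply: (@continuous_comp _ _ _ (fun w : 'cV[R]_n => w - y)
  (fun u : 'cV[R]_n => `|u|)).
  exact: sub_continuous.
exact: norm_continuous.
Qed.

Lemma closed_norm_le n (y : 'cV[R]_n) e : closed [set w | `|w - y| <= e].
Proof.
exact: ((continuous_closedP _).1 (@norm_sub_continuous n y) _ (@closed_le _ e)).
Qed.

Lemma closed_mulmx_eq0 m n (W : 'M[R]_(m, n)) (y : 'cV[R]_n) :
  closed [set w | W *m (w - y) = 0].
Proof.
have c : continuous (fun w : 'cV[R]_n => `|W *m (w - y)|).
  move=> w; apply: (@continuous_comp _ _ _ (fun w : 'cV[R]_n => W *m (w - y))
    (fun u : 'cV[R]_m => `|u|)); last exact: norm_continuous.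
  apply: (@continuous_comp _ _ _ (fun w : 'cV[R]_n => w - y) (mulmx W)).
    exact: sub_continuous.
  exact: mulmxr_continuous.
rewrite (_ : mkset _ = [set w | `|W *m (w - y)| <= 0]).
  exact: ((continuous_closedP _).1 c _ (@closed_le _ 0)).
by apply/seteqP; split=> w /=; [move->; rewrite normr0|rewrite normr_le0 => /eqP].
Qed.

Lemma column_min n (S : set 'cV[R]_n) (phi : 'cV[R]_n -> R) b :
  S !=set0 -> closed S -> (forall u, S u -> `|u| <= b) ->
  (forall u, S u -> {for u, continuous phi}) ->
  exists2 w, S w & forall u, S u -> phi w <= phi u.
Proof.
move=> S0 Scl Sb cphi.
have cS : compact S.
  have -> : S = [set u^T | u in [set v : 'rV[R]_n | S v^T]].
    apply/seteqP; split=> [u Su|_ [v Sv <-]//].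
    by exists u^T; rewrite /= trmxK.
  apply: continuous_compact.
    by apply: continuous_subspaceT; exact: trmx_continuous.
  apply: bounded_closed_compact.
    exists b; split; first exact: num_real.
    move=> M bM v /= /Sb; rewrite -[v in `|v| <= M]trmxK => vb.
    by rewrite (le_trans (norm_trmx _))// (le_trans vb)// ltW.
  by apply: (preimage_closed _ Scl) => v _; exact: trmx_continuous.
have [|w wS H] := compact_EVT_min S0 cS (f := phi).
  by apply: continuous_in_subspaceT => u /set_mem; exact: cphi.
by exists w => [|u Su]; [exact: set_mem|exact/H/mem_set].
Qed.

End ColumnSpaces.

(** * Constant rank near a feasible point *)

Section LocalSolvability.
Variable R : realType.

Lemma diff_line n p (G : 'cV[R]_n -> 'cV[R]_p) w d e :
  differentiable G w -> 0 < e -> exists2 t, 0 < t &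
    forall h, 0 <= h <= t ->
      `|G (w + h *: d) - G w - h *: 'd G w d| <= e * h.
Proof.
move=> dG e0; have d1 : 0 < `|d| + 1 by rewrite ltr_wpDl.
have [t t0 H] := near0_line d (diff_eps dG (divr_gt0 e0 d1)).
exists t => // h ht; have /andP[h0 _] := ht.
have := H h ht; rewrite linearZ /= => /le_trans; apply.
rewrite normrZ (ger0_norm h0) mulrA mulrAC ler_wpM2r//.
by rewrite mulrAC ler_pdivrMr// ler_wpM2l ?(ltW e0)// lerDl.
Qed.

Section ConstantRank.
Variables (n p r : nat) (G : 'cV[R]_n -> 'cV[R]_p) (y : 'cV[R]_n).
Variables (DG : 'cV[R]_n -> 'M[R]_(p, n)).
Variables (B : 'M[R]_(n, r)) (T : 'M[R]_(r, p)).
Hypothesis Gy : G y = 0.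
Hypothesis dG : \forall w \near y, differentiable G w.
Hypothesis DGE : forall w d, 'd G w d = DG w *m d.
Hypothesis cG : {for y, continuous DG}.
Hypothesis TB : T *m DG y *m B = 1%:M.

Let dGy : differentiable G y. Proof. exact: nbhs_singleton dG. Qed.

Lemma near_grad_bound : exists2 b, 0 < b &
  \forall w \near y, forall u : 'cV[R]_n, `|DG w *m u| <= b * `|u|.
Proof.
have [b b0 Hb] := mulmx_bound (DG y); exists (b + 1).
  by rewrite addr_gt0.
apply: filterS (near_mulmx cG ltr01) => w Hw u.
rewrite -[X in X *m u](subrK (DG y)) mulmxDl.
by rewrite (le_trans (ler_normD _ _))// addrC mulrDl lerD.
Qed.

Lemma near_inverse : \forall w \near y, forall a : 'cV[R]_r,
  `|T *m DG w *m (B *m a) - a| <= 2^-1 * `|a|.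
Proof.
have [t t0 Ht] := mulmx_bound T; have [b b0 Hb] := mulmx_bound B.
have e0 : 0 < (2 * t * b)^-1 by rewrite invr_gt0 !mulr_gt0.
apply: filterS (near_mulmx cG e0) => w Hw a.
have -> : T *m DG w *m (B *m a) - a =
    T *m ((DG w - DG y) *m (B *m a)).
  by rewrite [in RHS]mulmxBl [in RHS]mulmxBr !mulmxA TB mul1mx.
rewrite (le_trans (Ht _))//; apply: le_trans (ler_wpM2l (ltW t0) (Hw _)) _.
apply: le_trans (ler_wpM2l (ltW t0) (ler_wpM2l (ltW e0) (Hb _))) _.
by rewrite le_eqVlt; apply/orP; left; apply/eqP; field; rewrite !gt_eqF.
Qed.

Lemma near_inverse_le : \forall w \near y, forall a : 'cV[R]_r,
  `|a| <= 2 * `|T *m DG w *m (B *m a)|.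
Proof.
apply: filterS near_inverse => w H a; have := H a; set u := _ *m (B *m a).
have : `|a| <= `|u| + `|u - a|.
  by rewrite -[X in `|X| <= _](subKr u) (le_trans (ler_normB _ _)).
lra.
Qed.

Lemma near_inverse_ex : \forall w \near y, forall s : 'cV[R]_r,
  exists a, T *m DG w *m (B *m a) = s.
Proof.
apply: filterS near_inverse_le => w H s.
set N := T *m DG w *m B.
have Nu : N \in unitmx.
  rewrite -unitmx_tr -row_free_unit -kermx_eq0; apply/eqP/row_matrixP => i.
  rewrite row0; apply: trmx_inj; rewrite trmx0; apply/eqP.
  rewrite -normr_le0 (le_trans (H _))// mulmxA.
  rewrite -/N -[X in X *m _]trmxK -trmx_mul -row_mul mulmx_ker row0 trmx0 normr0.
  by rewrite mulr0.
by exists (invmx N *m s); rewrite mulmxA -/N mulmxA mulmxV// mul1mx.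
Qed.

Lemma near_linearize e : 0 < e ->
  \forall w \near y, `|G w - DG w *m (w - y)| <= e * `|w - y|.
Proof.
move=> e0; have e2 : 0 < e / 2 by rewrite divr_gt0.
have H1 : \forall w \near y,
    `|G w - DG y *m (w - y)| <= e / 2 * `|w - y|.
  have /near_normP[d d0 Hd] := diff_eps dGy e2.
  apply/near_normP; exists d => // w wy.
  have := Hd (w - y); rewrite subr0 => /(_ wy).
  by rewrite (addrC y) subrK Gy subr0 DGE.
apply: filterS2 H1 (near_mulmx cG e2) => w H1 /(_ (w - y)) H2.
have -> : G w - DG w *m (w - y) = (G w - DG y *m (w - y))
    - (DG w - DG y) *m (w - y).
  by rewrite mulmxBl opprB addrA subrK.
by rewrite (le_trans (ler_normB _ _))// (le_trans (lerD H1 H2))// -mulrDl -splitr.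
Qed.

(** The first [r] combinations [T G] of the components control the others:
    [|G w| <= kk * |T G w|] for [w] near [y] in the affine space.  To see this,
    let [|G| - kk * |T G| - th * |w - y|] be maximal at [w].  The step
    [B a - (w - y)], with [a] chosen so that [T G] decreases at rate [T G w],
    stays in the affine space; along it [|G|] decreases at rate at most
    [kk * |T G w|], by the rank condition, and [|w - y|] decreases.  So
    [w = y], and the inequality follows as [th] tends to zero. *)
Lemma constant_rank_vanishing k (W : 'M[R]_(k, n)) :
  W *m B = 0 ->
  (\forall w \near y, W *m (w - y) = 0 -> forall d : 'cV[R]_n, W *m d = 0 ->
     exists a, DG w *m d = DG w *m (B *m a)) ->
  \forall w \near y, W *m (w - y) = 0 -> T *m G w = 0 -> G w = 0.
Proof.
move=> WB rk.
have [t t0 Ht] := mulmx_bound T; have [b b0 Hb] := mulmx_bound B.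
have [D D0 HD] := near_grad_bound.
have e1 : 0 < (4 * t * b)^-1 by rewrite invr_gt0 !mulr_gt0.
have [e0 e0gt H] : exists2 e0, 0 < e0 & forall w, `|w - y| <= e0 ->
    [/\ (W *m (w - y) = 0 -> forall d : 'cV[R]_n, W *m d = 0 ->
          exists a, DG w *m d = DG w *m (B *m a)),
        differentiable G w, forall u : 'cV[R]_n, `|DG w *m u| <= D * `|u|
      & [/\ forall a : 'cV[R]_r, `|a| <= 2 * `|T *m DG w *m (B *m a)|,
        forall s : 'cV[R]_r, exists a, T *m DG w *m (B *m a) = s
      & `|G w - DG w *m (w - y)| <= (4 * t * b)^-1 * `|w - y|]].
  apply/near_normP.
  have H6 := near_linearize e1.
  have H5 := near_inverse_ex; have H4 := near_inverse_le.
  near=> w; split; [by near: w|by near: w|by near: w|].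
  by split; near: w.
pose kk := 2 * D * b.
have kk0 : 0 < kk by rewrite !mulr_gt0.
pose K := [set w | `|w - y| <= e0 /\ W *m (w - y) = 0].
have Ky : K y by rewrite /K /= subrr normr0 mulmx0 ltW.
have Kcl : closed K.
  apply: closedI; [exact: closed_norm_le|exact: closed_mulmx_eq0].
have Kb u : K u -> `|u| <= e0 + `|y|.
  move=> [uy _]; rewrite -[u](subrK y) (le_trans (ler_normD _ _))//.
  by rewrite lerD2r.
suff main w : K w -> `|G w| <= kk * `|T *m G w|.
  apply/near_normP; exists e0 => // w wy Ww TG0.
  have := main w (conj wy Ww).
  by rewrite TG0 normr0 mulr0 normr_le0 => /eqP.
suff main th : 0 < th -> forall w, K w ->
    `|G w| <= kk * `|T *m G w| + th * `|w - y|.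
  move=> Kw; apply/ler_addgt0Pr => e egt.
  have y1 : 0 < `|w - y| + 1 by rewrite ltr_wpDl.
  apply: (le_trans (main _ (divr_gt0 egt y1) w Kw)).
  rewrite lerD2l mulrAC ler_pdivrMr// ler_wpM2l ?(ltW egt)// lerDl//.
move=> {w} th0.
pose phi w := kk * `|T *m G w| + th * `|w - y| - `|G w|.
have cphi u : K u -> {for u, continuous phi}.
  move=> [uy _]; have [_ /differentiable_continuous cGu _ _] := H u uy.
  have c1 : {for u, continuous (fun w => `|G w|)}.
    apply: (@continuous_comp _ _ _ G (fun v : 'cV[R]_p => `|v|)) => //.
    exact: norm_continuous.
  have c2 : {for u, continuous (fun w => `|T *m G w|)}.
    apply: (@continuous_comp _ _ _ G (fun v : 'cV[R]_p => `|T *m v|)) => //.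
    apply: (@continuous_comp _ _ _ (mulmx T) (fun v : 'cV[R]_r => `|v|)).
      exact: mulmxr_continuous.
    exact: norm_continuous.
  have c3 := @norm_sub_continuous _ _ y u.
  apply: (@continuousB _ _ _ (fun w => kk * `|T *m G w| + th * `|w - y|)) => //.
  apply: (@continuousD _ _ _ (fun w => kk * `|T *m G w|)).
    by apply: continuousM => //; exact: cst_continuous.
  by apply: continuousM => //; exact: cst_continuous.
have [w Kw wmin] := column_min (ex_intro _ y Ky) Kcl Kb cphi.
suff wy : w = y.
  move=> u /wmin; rewrite /phi wy Gy mulmx0 subrr !normr0 !mulr0 addr0 subr0.
  by rewrite subr_ge0.
apply/eqP; rewrite -subr_eq0 -normr_eq0; apply/negP => /negP w0.
have {}w0 : 0 < `|w - y| by rewrite lt_def w0 /=.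
set rho := `|w - y| in w0.
have [wy Ww] := Kw; have [rkw dGw HDw [Hinv Hex Hlin]] := H w wy.
have [a Na] := Hex (T *m (DG w *m (w - y) - G w)).
have Ba : `|B *m a| <= rho / 2.
  rewrite (le_trans (Hb _))//.
  apply: le_trans (ler_wpM2l (ltW b0) (Hinv _)) _; rewrite Na.
  apply: le_trans (ler_wpM2l (ltW b0) (ler_wpM2l (ler0n _ 2) (Ht _))) _.
  rewrite distrC in Hlin.
  have h0 : 0 <= b * (2 * t) by rewrite !mulr_ge0 ?ltW.
  rewrite [2 * (t * _)]mulrA mulrA.
  apply: le_trans (ler_wpM2l h0 Hlin) _; rewrite -/rho.
  by rewrite le_eqVlt; apply/orP; left; apply/eqP; field; rewrite !gt_eqF.
pose e := B *m a - (w - y).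
have We : W *m e = 0 by rewrite mulmxBr mulmxA WB mul0mx Ww subrr.
have TDe : T *m (DG w *m e) = - (T *m G w).
  rewrite /e [DG w *m _]mulmxBr mulmxBr [T *m (DG w *m (B *m a))]mulmxA Na.
  by rewrite mulmxBr addrAC subrr add0r.
have DGe : `|DG w *m e| <= kk * `|T *m G w|.
  have [a' Ea'] := rkw Ww _ We.
  rewrite -[`|T *m G w|]normrN -TDe Ea' [T *m _]mulmxA.
  rewrite (le_trans (HDw _))// /kk -(mulrA 2) (mulrC 2) -!mulrA.
  rewrite ler_wpM2l ?(ltW D0)// (le_trans (Hb _))// ler_wpM2l ?(ltW b0)//.
(* The first-order remainders then cost at most half of the gain
   [h * th * rho / 2] in [th * |w - y|]. *)
have eps0 : 0 < th * rho / 4 / (1 + kk * t).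
  by rewrite !divr_gt0 ?mulr_gt0// addr_gt0// mulr_gt0.
have [h0 h0gt Hh] := diff_line e dGw eps0.
pose h := Num.min h0 1.
have hgt : 0 < h by rewrite lt_min h0gt ltr01.
have h1 : h <= 1 by rewrite ge_min lexx orbT.
have := Hh h; rewrite DGE (ltW hgt) ge_min lexx => /(_ isT).
set g := G (w + h *: e); set eps := _ / (1 + kk * t) in eps0 Hh *.
set rem := g - G w - _ => Hrem.
have gE : g = G w + h *: (DG w *m e) + rem.
  by rewrite /rem addrC -[X in X + _]addrA -opprD subrK.
have whE : w + h *: e - y = (1 - h) *: (w - y) + h *: (B *m a).
  rewrite /e; move: (B *m a) => u; apply/matrixP => i j; rewrite !mxE; ring.
have Nwh : `|w + h *: e - y| <= (1 - h / 2) * rho.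
  rewrite whE (le_trans (ler_normD _ _))// !normrZ ger0_norm ?subr_ge0//.
  rewrite (ger0_norm (ltW hgt)) -/rho.
  have := ler_wpM2l (ltW hgt) Ba; lra.
have Kwh : K (w + h *: e).
  split; last first.
    by rewrite whE mulmxDr -!scalemxAr Ww mulmxA WB mul0mx !scaler0 addr0.
  rewrite (le_trans Nwh)// (le_trans _ wy)// ler_piMl ?(ltW w0)//.
  by rewrite gerBl divr_ge0// ltW.
have := wmin _ Kwh; rewrite /phi -/g -/rho.
have G1 : `|G w| - h * (kk * `|T *m G w|) - eps * h <= `|g|.
  have -> : g = G w - (- (h *: (DG w *m e) + rem)).
    by rewrite opprK addrA; exact: gE.
  apply: le_trans (lerB_dist _ _); rewrite normrN -addrA -opprD lerD2l lerN2.
  rewrite (le_trans (ler_normD _ _))// lerD// normrZ (ger0_norm (ltW hgt)).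
  by rewrite ler_wpM2l// ltW.
have G2 : `|T *m g| <= (1 - h) * `|T *m G w| + t * (eps * h).
  have -> : T *m g = (1 - h) *: (T *m G w) + T *m rem.
    by rewrite gE 2!(mulmxDr T) -scalemxAr TDe scalerBl scale1r scalerN.
  rewrite (le_trans (ler_normD _ _))// normrZ ger0_norm ?subr_ge0// lerD2l.
  by rewrite (le_trans (Ht _))// ler_wpM2l// ltW.
have E : eps * (1 + kk * t) = th * rho / 4.
  by rewrite /eps divfK// gt_eqF// addr_gt0// mulr_gt0.
have G3 := ler_wpM2l (ltW kk0) G2.
have G4 := ler_wpM2l (ltW th0) Nwh.
have G5 : 0 < h * (th * rho) by rewrite !mulr_gt0.
have E' : eps * h + kk * (t * (eps * h)) = h * (th * rho) / 4.
  by have := congr1 (fun z => h * z) E; lra.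
set x1 := `|T *m g| in G2 G3 *; set x2 := `|T *m G w| in G1 G2 G3 *.
set x3 := `|_ + _ - y| in G4 *.
lra.
Unshelve. all: by end_near. Qed.

End ConstantRank.
End LocalSolvability.

(** * Metric regularity over a convex set *)

Section FeasibleDirections.
Variables (R : realType) (n : nat).
Implicit Types (X : set 'cV[R]_n) (w e : 'cV[R]_n).

Definition feasible_direction X w : set 'cV[R]_n :=
  [set e | exists2 t : R, 0 < t & forall h, 0 <= h <= t -> X (w + h *: e)].

Lemma feasible_direction0 X w : X w -> feasible_direction X w 0.
Proof. by move=> Xw; exists 1 => // h _; rewrite scaler0 addr0. Qed.

Lemma feasible_directionB X w z :
  convex_set X -> X w -> X z -> feasible_direction X w (z - w).
Proof. by move=> cX Xw Xz; exists 1 => // h h01; exact: convex_segment. Qed.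

Lemma feasible_directionZ X w e a :
  X w -> 0 <= a -> feasible_direction X w e -> feasible_direction X w (a *: e).
Proof.
move=> Xw; rewrite le_eqVlt => /predU1P[<- _|a0 [t t0 H]].
  by rewrite scale0r; exact: feasible_direction0.
exists (t / a) => [|h /andP[h0 ht]]; first by rewrite divr_gt0.
by rewrite scalerA; apply: H; rewrite mulr_ge0 ?(ltW a0)//= -ler_pdivlMr.
Qed.

Lemma feasible_directionD X w e1 e2 : convex_set X ->
  feasible_direction X w e1 -> feasible_direction X w e2 ->
  feasible_direction X w (e1 + e2).
Proof.
move=> cX [t1 t10 H1] [t2 t20 H2]; exists (Num.min t1 t2 / 2).
  by rewrite divr_gt0// lt_min t10.
move=> h /andP[h0]; rewrite ler_pdivlMr// le_min => /andP[ht1 ht2].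
have h20 : 0 <= h * 2 by rewrite mulr_ge0.
have half : 0 <= (2^-1 : R) <= 1 by rewrite invr_ge0 ler0n invf_le1// ler1n.
have := convex_segment cX (H1 (h * 2) _) (H2 (h * 2) _) half.
rewrite h20 => /(_ ht1 ht2); congr X.
by apply/matrixP => i j; rewrite !mxE; field.
Qed.

Lemma feasible_direction_sum X w m (e : 'I_m -> 'cV[R]_n) : convex_set X ->
  X w -> (forall i, feasible_direction X w (e i)) ->
  feasible_direction X w (\sum_i e i).
Proof.
move=> cX Xw H; apply: (big_ind (feasible_direction X w)) => //.
  exact: feasible_direction0.
by move=> e1 e2; exact: feasible_directionD.
Qed.

Lemma tangent_coneP X y d (e : R) : tangent_cone X y d -> 0 < e ->
  exists z s, [/\ X z, 0 <= s & `|s *: (z - y) - d| <= e].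
Proof.
move=> [u [t [Xt _ _ cv]]] e0.
have /cvgrPdist_le /(_ _ e0) [k _ Hk] := cv.
exists (u k), (t k)^-1; have [Xu tk] := Xt k; split=> //.
  by rewrite invr_ge0 ltW.
by rewrite distrC; apply: Hk => /=.
Qed.

(** A tangent direction at [y] stays feasible, up to a small error, from every
    point of [X] near [y]: head for one fixed point of [X]. *)
Lemma near_feasible_direction X y d (e : R) :
  convex_set X -> tangent_cone X y d -> 0 < e ->
  \forall w \near y, X w -> exists2 u, feasible_direction X w u & `|u - d| <= e.
Proof.
move=> cX Td e0; have e2 : 0 < e / 2 by rewrite divr_gt0.
have [z [s [Xz s0 Hz]]] := tangent_coneP Td e2.
have s1 : 0 < s + 1 by rewrite ltr_wpDl.
apply/near_normP; exists (e / 2 / (s + 1)) => [|w wy Xw].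
  by rewrite divr_gt0.
exists (s *: (z - w)).
  by apply: feasible_directionZ => //; exact: feasible_directionB.
have -> : s *: (z - w) - d = (s *: (z - y) - d) - s *: (w - y).
  by apply/matrixP => i j; rewrite !mxE; ring.
rewrite (le_trans (ler_normB _ _))// (splitr e) lerD// normrZ ger0_norm//.
apply: le_trans (ler_wpM2l s0 wy) _.
by rewrite mulrCA ler_piMr ?(ltW e2)// ler_pdivrMr// mul1r lerDl.
Qed.

Lemma near_feasible_range X y r (B : 'M[R]_(n, r)) (e : R) : convex_set X ->
  (forall j, tangent_lineality X y (col j B)) -> 0 < e ->
  \forall w \near y, X w -> forall a : 'cV[R]_r,
    exists2 u, feasible_direction X w u & `|u - B *m a| <= e * `|a|.
Proof.
move=> cX TB e0; have e1 : 0 < e / r.+1%:R by rewrite divr_gt0.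
pose P (j : 'I_r) w := X w ->
    (exists2 u, feasible_direction X w u & `|u - col j B| <= e / r.+1%:R) /\
    (exists2 u, feasible_direction X w u & `|u - - col j B| <= e / r.+1%:R).
have H : \forall w \near y, forall j, P j w.
  apply: (@filter_forall _ _ P (nbhs y)) => j; have [T1 T2] := TB j.
  have N1 := near_feasible_direction cX T1 e1.
  have N2 := near_feasible_direction cX T2 e1.
  by apply: filterS2 N1 N2 => w H1 H2 Xw; split; [exact: H1|exact: H2].
apply: filterS H => w H Xw a.
have /choice[u Hu] : forall j, exists u, feasible_direction X w u /\
    `|u - a j 0 *: col j B| <= `|a j 0| * (e / r.+1%:R).
  move=> j; have [[u1 F1 E1] [u2 F2 E2]] := H j Xw.
  have [a0|a0] := leP 0 (a j 0).
    exists (a j 0 *: u1); split; first exact: feasible_directionZ.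
    by rewrite -scalerBr normrZ ler_wpM2l.
  exists ((- a j 0) *: u2); split.
    by apply: feasible_directionZ; rewrite // oppr_ge0 ltW.
  rewrite (_ : - a j 0 *: u2 - a j 0 *: col j B =
               (- a j 0) *: (u2 - - col j B)); last first.
    by rewrite opprK scalerDr !scaleNr.
  by rewrite normrZ normrN ler_wpM2l.
exists (\sum_j u j).
  by apply: feasible_direction_sum => // j; case: (Hu j).
rewrite mulmx_sum_col -sumrB (le_trans (ler_norm_sum _ _ _))//.
apply: (@le_trans _ _ (\sum_(j < r) `|a| * (e / r.+1%:R))).
  apply: ler_sum => j _; have [_] := Hu j => /le_trans; apply.
  by rewrite ler_wpM2r ?(ltW e1)// coord_le_norm.
rewrite sumr_const card_ord -[leLHS]mulr_natl mulrCA [leRHS]mulrC ler_wpM2l//.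
by rewrite mulrCA ler_piMr ?(ltW e0)// ler_pdivrMr// mul1r ler_nat.
Qed.

End FeasibleDirections.

Section MetricRegularity.
Variables (R : realType) (n p r : nat) (X : set 'cV[R]_n).
Variables (G : 'cV[R]_n -> 'cV[R]_p) (y : 'cV[R]_n).
Variables (DG : 'cV[R]_n -> 'M[R]_(p, n)).
Variables (B : 'M[R]_(n, r)) (T : 'M[R]_(r, p)).
Hypothesis Gy : G y = 0.
Hypothesis dG : \forall w \near y, differentiable G w.
Hypothesis DGE : forall w d, 'd G w d = DG w *m d.
Hypothesis cG : {for y, continuous DG}.
Hypothesis TB : T *m DG y *m B = 1%:M.
Hypothesis Xcl : closed X.
Hypothesis cX : convex_set X.
Hypothesis XB : forall j, tangent_lineality X y (col j B).

(** From a point of [X] near [y], a feasible direction close to [- B (T G w)]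
    decreases [T G] at a rate proportional to [|T G w|]. *)
Lemma near_descent : exists2 b, 0 < b &
  \forall w \near y, X w -> exists2 e, feasible_direction X w e &
    `|e| <= b * `|T *m G w| /\
    `|T *m (DG w *m e) + T *m G w| <= 4^-1 * `|T *m G w|.
Proof.
have [t t0 Ht] := mulmx_bound T; have [b b0 Hb] := mulmx_bound B.
have [D D0 HD] := near_grad_bound cG.
exists (b + 1); first by rewrite addr_gt0.
(* A positive number below both 1 and (8 t D)^-1. *)
pose eta := (8 * t * D)^-1 / (1 + (8 * t * D)^-1).
have k0 : 0 < (8 * t * D)^-1 by rewrite invr_gt0 !mulr_gt0.
have k1 : 0 < 1 + (8 * t * D)^-1 by rewrite addr_gt0.
have eta0 : 0 < eta by rewrite divr_gt0.
have eta1 : eta <= 1 by rewrite ler_pdivrMr// mul1r lerDr.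
have etaD : t * D * eta <= 8^-1.
  have : eta <= (8 * t * D)^-1.
    by rewrite ler_pdivrMr// ler_peMr ?(ltW k0)// lerDl ltW.
  move=> /(ler_wpM2l (ltW (mulr_gt0 t0 D0))) /le_trans; apply.
  by rewrite le_eqVlt; apply/orP; left; apply/eqP; field; rewrite !gt_eqF.
clearbody eta.
have e0 : 0 < (8 * t * b)^-1 by rewrite invr_gt0 !mulr_gt0.
have N1 := near_feasible_range cX XB eta0.
have N2 := near_mulmx (n := n) cG e0.
near=> w => Xw.
have HDw : forall u : 'cV[R]_n, `|DG w *m u| <= D * `|u| by near: w.
have Hw : forall u : 'cV[R]_n, `|(DG w - DG y) *m u| <= (8 * t * b)^-1 * `|u|.
  by near: w.
have H : X w -> forall a : 'cV[R]_r,
    exists2 u, feasible_direction X w u & `|u - B *m a| <= eta * `|a|.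
  by near: w.
have [e Fe He] := H Xw (- (T *m G w)); rewrite normrN in He.
exists e => //; split.
  rewrite -[e](subrK (B *m - (T *m G w))) (le_trans (ler_normD _ _))//.
  rewrite mulrDl addrC lerD//.
    by rewrite (le_trans (Hb _))// normrN.
  by rewrite mul1r (le_trans He)// ler_piMl.
set a := - (T *m G w) in He *.
have -> : T *m (DG w *m e) + T *m G w = T *m (DG w *m (e - B *m a))
    + T *m ((DG w - DG y) *m (B *m a)).
  rewrite mulmxBr (mulmxBr T) (mulmxBl (DG w)) (mulmxBr T).
  rewrite [T *m (DG y *m _)]mulmxA [T *m DG y *m (B *m a)]mulmxA TB mul1mx.
  by rewrite addrA subrK /a opprK.
have ga : `|T *m G w| = `|a| by rewrite normrN.
rewrite ga in He *; rewrite (le_trans (ler_normD _ _))//.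
have E1 : `|T *m (DG w *m (e - B *m a))| <= 8^-1 * `|a|.
  rewrite (le_trans (Ht _))//.
  apply: le_trans (ler_wpM2l (ltW t0) (HDw _)) _.
  apply: le_trans (ler_wpM2l (ltW t0) (ler_wpM2l (ltW D0) He)) _.
  by rewrite !mulrA ler_wpM2r.
have E2 : `|T *m ((DG w - DG y) *m (B *m a))| <= 8^-1 * `|a|.
  rewrite (le_trans (Ht _))//.
  apply: le_trans (ler_wpM2l (ltW t0) (Hw _)) _.
  apply: le_trans (ler_wpM2l (ltW t0) (ler_wpM2l (ltW e0) (Hb _))) _.
  by rewrite le_eqVlt; apply/orP; left; apply/eqP; field; rewrite !gt_eqF.
by have := lerD E1 E2; lra.
Unshelve. all: by end_near. Qed.

(** A minimizer [w] of [|T G| + e * |w - z|] over the points of [X] near [y]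
    solves [T G w = 0]: otherwise the descent direction of [near_descent] would
    decrease the first term by more than it can increase the second.
    Comparing with the value at [z] bounds [|w - z|]. *)
Lemma metric_regularity : exists2 k, 0 < k &
  \forall z \near y, X z -> exists w,
    [/\ X w, T *m G w = 0 & `|w - z| <= k * `|T *m G z|].
Proof.
have [b b0 Hb] := near_descent; have [t t0 Ht] := mulmx_bound T.
(* Along the descent direction [e * |w - z|] grows at most at a quarter of
   the rate [|T *m G w|]. *)
pose e := (4 * b)^-1; have e0 : 0 < e by rewrite invr_gt0 mulr_gt0.
have eb : e * b = 4^-1 by rewrite /e invfM mulrC mulrCA mulfV ?mulr1// gt_eqF.
have [d dgt H] : exists2 d, 0 < d & forall w, `|w - y| <= d ->
    differentiable G w /\ (X w -> exists2 e, feasible_direction X w e &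
    `|e| <= b * `|T *m G w| /\
    `|T *m (DG w *m e) + T *m G w| <= 4^-1 * `|T *m G w|).
  by apply/near_normP; near=> w; split; near: w.
exists e^-1; first by rewrite invr_gt0.
have cGy : {for y, continuous G}.
  exact: differentiable_continuous (nbhs_singleton dG).
have ed : 0 < e * d / 4 / t by rewrite !divr_gt0// mulr_gt0.
have d2 : 0 < d / 2 by rewrite divr_gt0.
have N1 : \forall z \near y, `|z - y| <= d / 2.
  by apply/near_normP; exists (d / 2).
have N2 : \forall z \near y, `|G z| <= e * d / 4 / t.
  have /cvgrPdist_le /(_ _ ed) := cGy; apply: filterS => z.
  by rewrite Gy sub0r normrN.
apply: filterS2 N1 N2 => z zy Gz Xz.
have TGz : `|T *m G z| <= e * d / 4.
  rewrite (le_trans (Ht _))//; apply: le_trans (ler_wpM2l (ltW t0) Gz) _.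
  by rewrite mulrC divfK ?gt_eqF.
pose K := X `&` [set w | `|w - y| <= d].
have Kz : K z.
  split=> //=; rewrite (le_trans zy)// ler_pdivrMr//.
  by rewrite ler_peMr ?(ltW dgt)// ler1n.
have Kcl : closed K by apply: closedI => //; exact: closed_norm_le.
have Kb u : K u -> `|u| <= d + `|y|.
  move=> [_ /= uy]; rewrite -[u](subrK y) (le_trans (ler_normD _ _))//.
  by rewrite lerD2r.
pose phi w := `|T *m G w| + e * `|w - z|.
have cphi u : K u -> {for u, continuous phi}.
  move=> [_ /= uy]; have [/differentiable_continuous cGu _] := H u uy.
  have c2 : {for u, continuous (fun w => `|T *m G w|)}.
    apply: (@continuous_comp _ _ _ G (fun v : 'cV[R]_p => `|T *m v|)) => //.
    apply: (@continuous_comp _ _ _ (mulmx T) (fun v : 'cV[R]_r => `|v|)).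
      exact: mulmxr_continuous.
    exact: norm_continuous.
  have c3 := @norm_sub_continuous _ _ z u.
  apply: (@continuousD _ _ _ (fun w => `|T *m G w|)) => //.
  by apply: continuousM => //; exact: cst_continuous.
have [w Kw wmin] := column_min (ex_intro _ z Kz) Kcl Kb cphi.
have [Xw /= wy] := Kw.
have wz : `|w - z| <= e^-1 * `|T *m G z|.
  rewrite ler_pdivlMl//; have := wmin z Kz.
  by rewrite /phi subrr normr0 mulr0 addr0; apply: le_trans; rewrite lerDr.
exists w; split=> //; apply/eqP; rewrite -normr_eq0; apply/negP => /negP g0.
have {}g0 : 0 < `|T *m G w| by rewrite lt_def g0 /=.
set g := `|T *m G w| in g0.
have wy' : `|w - y| <= 3 / 4 * d.
  have -> : w - y = (w - z) + (z - y) by rewrite addrA subrK.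
  rewrite (le_trans (ler_normD _ _))//.
  have : `|w - z| <= d / 4.
    apply: (le_trans wz); rewrite ler_pdivrMl//.
    by apply: (le_trans TGz); rewrite mulrA.
  lra.
have [dGw Hw] := H w wy; have [v [t1 t10 Xv] [vb vd]] := Hw Xw.
have eps0 : 0 < g / 4 / t by rewrite !divr_gt0.
have [t2 t20 Hv] := diff_line v dGw eps0.
have v1 : 0 < `|v| + 1 by rewrite ltr_wpDl.
pose h := Num.min (Num.min t1 t2) (Num.min 1 (d / 4 / (`|v| + 1))).
have h0 : 0 < h by rewrite !lt_min t10 t20 ltr01 !divr_gt0.
have [ht1 ht2 h1 h3] : [/\ h <= t1, h <= t2, h <= 1 & h <= d / 4 / (`|v| + 1)].
  by split; rewrite !ge_min lexx ?orbT.
have Khv : K (w + h *: v).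
  split; first by apply: Xv; rewrite (ltW h0).
  rewrite /= addrAC (le_trans (ler_normD _ _))// normrZ (ger0_norm (ltW h0)).
  have : h * `|v| <= d / 4.
    rewrite ler_pdivlMr// in h3; apply: le_trans h3.
    by rewrite ler_wpM2l ?(ltW h0)// lerDl.
  lra.
have := wmin _ Khv; rewrite /phi -/g.
have := Hv h; rewrite DGE (ltW h0) ht2 => /(_ isT).
set rem := _ - _ - _ => Hrem.
have G1 : `|T *m G (w + h *: v)| <= (1 - h) * g + h * (4^-1 * g) + h * (g / 4).
  have -> : T *m G (w + h *: v) = (1 - h) *: (T *m G w)
      + h *: (T *m (DG w *m v) + T *m G w) + T *m rem.
    rewrite /rem !(mulmxBr T) -scalemxAr.
    move: (T *m _) (T *m _) (T *m _) => u1 u2 u3.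
    by apply/matrixP => i j; rewrite !mxE; ring.
  rewrite (le_trans (ler_normD _ _))// lerD//.
    rewrite (le_trans (ler_normD _ _))// !normrZ (ger0_norm (ltW h0)).
    by rewrite ger0_norm ?subr_ge0// lerD2l ler_wpM2l// ltW.
  rewrite (le_trans (Ht _))//; apply: le_trans (ler_wpM2l (ltW t0) Hrem) _.
  by rewrite le_eqVlt; apply/orP; left; apply/eqP; field; rewrite gt_eqF.
have G2 : e * `|w + h *: v - z| <= e * `|w - z| + h * (4^-1 * g).
  rewrite addrAC; apply: le_trans (ler_wpM2l (ltW e0) (ler_normD _ _)) _.
  rewrite mulrDr lerD2l normrZ (ger0_norm (ltW h0)) mulrCA ler_wpM2l ?(ltW h0)//.
  by apply: le_trans (ler_wpM2l (ltW e0) vb) _; rewrite mulrA eb.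
have G3 : 0 < h * g by rewrite mulr_gt0.
lra.
Unshelve. all: by end_near. Qed.

End MetricRegularity.

(** * Polarity and linear algebra *)

Section Polarity.
Variables (R : realType) (n : nat) (X : set 'cV[R]_n) (y : 'cV[R]_n).
Hypothesis cX : convex_set X.
Hypothesis Xy : X y.

(** The closure of the cone of feasible directions, that is, the tangent cone. *)
Let Kc : set 'cV[R]_n := [set q | forall e : R, 0 < e ->
  exists2 u, feasible_direction X y u & `|u - q| <= e].

Let Kc_feasible u : feasible_direction X y u -> Kc u.
Proof. by move=> Fu e e0; exists u => //; rewrite subrr normr0 ltW. Qed.

Let Kc_closed : closed Kc.
Proof.
move=> q clq e e0; have e2 : 0 < e / 2 by rewrite divr_gt0.
have [q' [Kq' /=]] := clq _ (nbhsx_ballx q _ e2).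
rewrite -ball_normE /= => qq'; have [u Fu uq'] := Kq' _ e2; exists u => //.
have -> : u - q = (u - q') - (q - q') by rewrite opprB addrA subrK.
by rewrite (le_trans (ler_normB _ _))// (splitr e) lerD// ltW.
Qed.

Let KcD q1 q2 a : 0 <= a <= 1 -> Kc q1 -> Kc q2 -> Kc (q1 + a *: (q2 - q1)).
Proof.
move=> /andP[a0 a1] K1 K2 e e0.
have [u1 F1 E1] := K1 e e0; have [u2 F2 E2] := K2 e e0.
have a1' : 0 <= 1 - a by rewrite subr_ge0.
exists ((1 - a) *: u1 + a *: u2).
  by apply: feasible_directionD => //; exact: feasible_directionZ.
have -> : (1 - a) *: u1 + a *: u2 - (q1 + a *: (q2 - q1)) =
    (1 - a) *: (u1 - q1) + a *: (u2 - q2).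
  by apply/matrixP => i j; rewrite !mxE; ring.
rewrite (le_trans (ler_normD _ _))// !normrZ !ger0_norm//.
have := ler_wpM2l a1' E1; have := ler_wpM2l a0 E2; lra.
Qed.

Let KcZ q a : 0 <= a -> Kc q -> Kc (a *: q).
Proof.
move=> a0 Kq e e0; have a1 : 0 < a + 1 by rewrite ltr_wpDl.
have [u Fu Eu] := Kq _ (divr_gt0 e0 a1).
exists (a *: u); first exact: feasible_directionZ.
rewrite -scalerBr normrZ ger0_norm//; apply: le_trans (ler_wpM2l a0 Eu) _.
by rewrite mulrCA ler_piMr ?(ltW e0)// ler_pdivrMr// mul1r lerDl.
Qed.

(** Project [d] on the closed convex cone spanned by [X - y]: the difference
    with the projection is a normal vector, and is orthogonal to the
    projection, so that its square is its inner product with [d]. *)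
Lemma feasible_direction_polar d e :
  (forall v, normal_cone X y v -> inner v d <= 0) -> 0 < e ->
  exists2 u, feasible_direction X y u & `|u - d| <= e.
Proof.
move=> dN; suff : Kc d by apply.
pose b := l2norm d + l2norm d.
pose K := Kc `&` [set w | `|w - 0| <= b].
pose phi (w : 'cV[R]_n) := inner (w - d) (w - d).
have K0 : Kc 0 by apply: Kc_feasible; exact: feasible_direction0.
have [q Kq qmin] :
    exists2 q, Kc q & forall k, Kc k -> l2norm (d - q) <= l2norm (d - k).
  have [||u [_]|u _|q [Kq _] qmin] := @column_min R n K phi b.
  - by exists 0; split=> //=; rewrite subrr normr0 addr_ge0 ?l2norm_ge0.
  - by apply: closedI => //; exact: closed_norm_le.
  - by rewrite /= subr0.
  - have cq := differentiable_continuous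
      (ex_diff (is_diff_def := diff_sqnorm (u - d))).
    exact: (continuous_comp (@sub_continuous R n d u) cq).
  have phiE w : phi w = l2norm (d - w) ^+ 2.
    by rewrite /phi -sqr_l2norm -(l2normN (d - w)) opprB.
  exists q => // k Kk.
  have [kb|kb] := leP `|k| b.
    have /qmin : K k by split=> //=; rewrite subr0.
    by rewrite !phiE ler_pXn2r ?nnegrE ?l2norm_ge0.
  have /qmin : K 0 by split=> //=; rewrite subrr normr0 addr_ge0 ?l2norm_ge0.
  rewrite !phiE ler_pXn2r ?nnegrE ?l2norm_ge0// subr0 => /le_trans; apply.
  have : l2norm k <= l2norm (d - k) + l2norm d.
    by rewrite -(l2normN (d - k)) opprB (le_trans _ (l2normD _ _))// subrK.
  have := norm_le_l2norm k; move: kb; rewrite /b; lra.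
have var k : Kc k -> inner (d - q) (k - q) <= 0.
  move=> Kk; rewrite leNgt; apply/negP => g0.
  set g := inner _ _ in g0; set s := inner (k - q) (k - q).
  have s0 : 0 <= s by exact: inner_ge0.
  have sg : 0 < s + g by rewrite ltr_wpDl.
  pose h := g / (s + g).
  have h0 : 0 < h by rewrite divr_gt0.
  have h1 : h <= 1 by rewrite ler_pdivrMr// mul1r lerDr.
  have := qmin _ (@KcD q k h _ Kq Kk); rewrite (ltW h0) => /(_ h1).
  rewrite -(@ler_pXn2r _ 2)// ?nnegrE ?l2norm_ge0// !sqr_l2norm.
  have -> : d - (q + h *: (k - q)) = (d - q) - h *: (k - q).
    by rewrite opprD addrA.
  have E a z : inner (a - h *: z) (a - h *: z) =
      inner a a - h * (2 * inner a z - h * inner z z).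
    by rewrite innerBl !innerBr !innerZr !innerZl (innerC z a); ring.
  rewrite E -/g -/s => H.
  have hs : h * s < g by rewrite /h mulrAC ltr_pdivrMr// ltr_pM2l// ltrDl.
  have : 0 < h * (2 * g - h * s) by rewrite mulr_gt0//; lra.
  lra.
have dq0 : inner (d - q) q = 0.
  apply/eqP; rewrite eq_le; apply/andP; split.
    have := var _ (KcZ (ler0n _ 2) Kq).
    by rewrite scaler_nat mulr2n addrK.
  have := var _ K0; rewrite sub0r innerNr; lra.
have Ndq : normal_cone X y (d - q).
  move=> z Xz; have := var _ (Kc_feasible (feasible_directionB cX Xy Xz)).
  by rewrite innerBr dq0 subr0.
suff /eqP : d - q = 0 by rewrite subr_eq0 => /eqP ->.
apply/inner_eq0/eqP; rewrite eq_le inner_ge0 andbT innerBr dq0 subr0.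
exact: dN.
Qed.

End Polarity.

Section LinearAlgebra.
Variable R : realType.

(** Choose columns in [S] of maximal rank. *)
Lemma spanning_columns n (S : set 'cV[R]_n) : exists m (M : 'M[R]_(n, m)),
  (forall j, S (col j M)) /\ forall s, S s -> exists a, s = M *m a.
Proof.
pose P k := `[< exists m (M : 'M[R]_(n, m)),
  (forall j, S (col j M)) /\ \rank M = k >].
have P0 : exists k, P k.
  exists 0%N; apply/asboolP; exists 0%N, 0; split; last exact: mxrank0.
  by case.
have Pn k : P k -> (k <= n)%N.
  by move=> /asboolP[m [M [_ <-]]]; exact: rank_leq_row.
have [k /asboolP[m [M [SM rM]]] kmax] := ex_maxnP P0 Pn.
exists m, M; split=> // s Ss.
suff /submxP[a] : (s^T <= M^T)%MS.
  by move=> /(congr1 trmx); rewrite trmxK trmx_mul trmxK => ->; exists a^T.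
have sub : (M^T <= col_mx M^T s^T)%MS by rewrite -addsmxE addsmxSl.
have /geq_leqif := mxrank_leqif_sup sub.
rewrite mxrank_tr rM -tr_row_mx mxrank_tr kmax => [/esym|].
  by rewrite tr_row_mx col_mx_sub => /andP[].
apply/asboolP; exists (m + 1)%N, (row_mx M s); split=> // j.
case: (split_ordP j) => j' ->; first by rewrite colKl.
by rewrite colKr ord1 col_id.
Qed.

(** By the last hypothesis [J^T] is the identity on the orthogonal complement of
    the sum of the ranges of [C] and [M], so this complement is orthogonal to
    the kernel of [J], and the kernel lies in that sum.  The component of [u] in
    the range of [M] is fixed by [J], hence equal to [J u = 0]. *)
Lemma kernel_range n p m (J : 'M[R]_n) (C : 'M[R]_(n, p)) (M : 'M[R]_(n, m))
    (u : 'cV[R]_n) :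
  J *m u = 0 -> J *m C = 0 -> J *m M = M ->
  (forall d : 'cV[R]_n, C^T *m d = 0 -> M^T *m d = 0 -> J^T *m d = d) ->
  exists a, u = C *m a.
Proof.
move=> Ju JC JM H; pose U := col_mx C^T M^T.
have colU (d : 'cV[R]_n) : U *m d = 0 -> J^T *m d = d.
  rewrite /U mul_col_mx -(col_mx0 _ p m 1) => /eq_col_mx[Cd Md].
  exact: H.
have JK : J^T *m cokermx U = cokermx U.
  apply/matrixP => i j.
  have /colU : U *m col j (cokermx U) = 0.
    by rewrite colE mulmxA mulmx_coker mul0mx.
  by rewrite colE mulmxA -!colE => /matrixP /(_ i 0); rewrite !(mxE, col_id).
have : (u^T <= U)%MS.
  rewrite submxE -JK mulmxA -trmx_mul Ju trmx0 mul0mx; exact/eqP.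
case/submxP => a /(congr1 trmx); rewrite trmxK trmx_mul tr_col_mx !trmxK.
rewrite -(vsubmxK a^T) mul_row_col => E.
have : J *m u = M *m dsubmx a^T.
  by rewrite E mulmxDr !mulmxA JC JM mul0mx add0r.
by rewrite Ju => M0; exists (usubmx a^T); rewrite E -M0 addr0.
Qed.

End LinearAlgebra.

(** * Rank conditions and the affine hull *)

Section Dimension.
Variable R : realType.

Lemma left_inverse_ex p r (N : 'M[R]_(p, r)) :
  (forall a : 'cV[R]_r, N *m a = 0 -> a = 0) -> exists T, T *m N = 1%:M.
Proof.
move=> Ninj; have Nfree : row_free N^T.
  rewrite -kermx_eq0; apply/eqP/row_matrixP => i.
  rewrite row0; apply: trmx_inj; rewrite trmx0; apply: Ninj.
  by rewrite -[X in X *m _]trmxK -trmx_mul -row_mul mulmx_ker row0 trmx0.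
exists (pinvmx N^T)^T; apply: trmx_inj.
by rewrite trmx_mul trmxK mulmxVp// trmx1.
Qed.

Lemma has_dim_lift n p r (F : 'M[R]_(p, n)) (L : set 'cV[R]_n) :
  has_dim [set F *m d | d in L] r -> exists (B : 'M[R]_(n, r)) (T : 'M[R]_(r, p)),
    (forall j, L (col j B)) /\ T *m F *m B = 1%:M.
Proof.
move=> [V SV dV]; subst r.
have /choice[d Hd] : forall j : 'I_(\dim V),
    exists d, L d /\ F *m d = (vbasis V)`_j.
  move=> j; have : (vbasis V)`_j \in V.
    by apply: vbasis_mem; rewrite mem_nth// size_tuple.
  have -> : ((vbasis V)`_j \in V) = [set u | u \in V] (vbasis V)`_j :> Prop by [].
  by rewrite -SV => -[d Ld Fd]; exists d.
pose B := \matrix_(i, j) d j i 0.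
have colB j : col j B = d j by apply/matrixP => i k; rewrite ord1 !mxE.
have [|T TN] := @left_inverse_ex _ _ (F *m B).
  move=> a; rewrite mulmx_sum_col => N0.
  have /freeP fr := basis_free (vbasisP V).
  apply/matrixP => i k; rewrite ord1 mxE; apply: (fr (fun j => a j 0)).
  rewrite -[RHS]N0; apply: eq_bigr => j _; congr (_ *: _).
  by have [_ <-] := Hd j; rewrite [RHS]colE -mulmxA -colE colB.
exists B, T; split=> [j|]; last by rewrite -mulmxA.
by rewrite colB; case: (Hd j).
Qed.

Lemma has_dim_span p r (S : set 'cV[R]_p) (N : 'M[R]_(p, r)) :
  has_dim S r -> (forall j, S (col j N)) ->
  (forall a : 'cV[R]_r, N *m a = 0 -> a = 0) ->
  forall s, S s -> exists a, s = N *m a.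
Proof.
move=> [V -> dV] SN Ninj s sV.
pose b := [tuple col j N | j < r].
have bE (j : 'I_r) : b`_j = col j N by rewrite -tnth_nth tnth_mktuple.
have bfree : free b.
  apply/freeP => k k0 i.
  have /Ninj : N *m \col_j k j = 0.
    rewrite mulmx_sum_col -[RHS]k0; apply: eq_bigr => j _.
    by rewrite bE !mxE.
  by move=> /matrixP /(_ i 0); rewrite !mxE.
have bV : basis_of V b.
  rewrite basisEfree bfree size_tuple dV leqnn andbT /=.
  by apply/span_subvP => _ /mapP[j _ ->]; exact: SN.
exists (\col_j coord b j s).
rewrite [LHS](coord_basis bV sV) mulmx_sum_col.
by apply: eq_bigr => j _; rewrite bE !mxE.
Qed.

End Dimension.

Section AffineHull.
Variables (R : realType) (n : nat).
Implicit Types (X : set 'cV[R]_n).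

Lemma aff_range X y m (M : 'M[R]_(n, m)) a : X y ->
  (forall j, exists2 z, X z & col j M = z - y) -> aff X (y + M *m a).
Proof.
move=> Xy HM.
exists m.+1, (fun i => oapp (fun j => a j 0) (1 - \sum_j a j 0) (unlift ord0 i)).
exists (fun i => oapp (fun j => y + col j M) y (unlift ord0 i)); split.
- move=> i; case: unliftP => [j _|_] //=.
  by have [z Xz ->] := HM j; rewrite addrC subrK.
- rewrite big_ord_recl unlift_none /= [X in _ + X](eq_bigr (fun j => a j 0)).
    by rewrite subrK.
  by move=> j _; rewrite liftK.
- rewrite big_ord_recl unlift_none /= [X in _ = _ + X](eq_bigr
    (fun j => a j 0 *: y + a j 0 *: col j M)).
    rewrite big_split/= -scaler_suml -mulmx_sum_col scalerBl scale1r.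
    by rewrite addrA subrK.
  by move=> j _; rewrite liftK /= scalerDr.
Qed.

(** The equations [W] define the direction of the affine hull; being linear,
    they pass to the limit, hence also hold on tangent cones. *)
Lemma affine_hull_equations X y : X y -> exists m (W : 'M[R]_(m, n)),
  [/\ forall z, X z -> W *m (z - y) = 0,
      forall w, W *m (w - y) = 0 -> aff X w
    & forall d, W *m d = 0 -> affdir X d].
Proof.
move=> Xy; have [m [M [HM MS]]] := spanning_columns [set z - y | z in X].
have HM' j : exists2 z, X z & col j M = z - y.
  by have [z Xz <-] := HM j; exists z.
have WM (d : 'cV[R]_n) : (cokermx M^T)^T *m d = 0 -> exists a, d = M *m a.
  move=> Wd; have /submxP[a Ea] : (d^T <= M^T)%MS.
    by rewrite submxE; apply/eqP/trmx_inj; rewrite trmx_mul trmxK trmx0.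
  by exists a^T; rewrite -[M]trmxK -trmx_mul -Ea trmxK.
have KM : (cokermx M^T)^T *m M = 0.
  by apply: trmx_inj; rewrite trmx_mul trmxK mulmx_coker trmx0.
exists n, (cokermx M^T)^T; split.
- move=> z Xz; have [|a ->] := MS (z - y); first by exists z.
  by rewrite mulmxA KM mul0mx.
- move=> w /WM[a E]; rewrite -(subrK y w) E addrC; exact: aff_range.
- by move=> d /WM[a ->]; exists y => //; exact: aff_range.
Qed.

Lemma tangent_cone_direction X y m (W : 'M[R]_(m, n)) d :
  (forall z, X z -> W *m (z - y) = 0) -> tangent_cone X y d -> W *m d = 0.
Proof.
move=> XW Td; have [b b0 Hb] := mulmx_bound W.
apply/eqP; rewrite -normr_le0; apply/ler_addgt0Pr => e e0; rewrite add0r.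
have [z [s [Xz _ Hz]]] := tangent_coneP Td (divr_gt0 e0 b0).
have -> : W *m d = W *m - (s *: (z - y) - d).
  by rewrite opprB mulmxBr -scalemxAr XW// scaler0 subr0.
rewrite (le_trans (Hb _))// normrN; apply: le_trans (ler_wpM2l (ltW b0) Hz) _.
by rewrite mulrC divfK// gt_eqF.
Qed.

End AffineHull.

(** * Tangent directions of the feasible set *)

Section TangentDirections.
Variables (R : realType) (n : nat).

Lemma diff_fixed_direction (A : 'cV[R]_n -> 'cV[R]_n) y d :
  differentiable A y -> A y = y ->
  (forall e t0 : R, 0 < e -> 0 < t0 -> exists t w,
     [/\ 0 < t <= t0, A w = w & `|w - (y + t *: d)| <= e * t]) ->
  (grad A y)^T *m d = d.
Proof.
move=> dA Ay H; have [b b0 Hb] := mulmx_bound (grad A y)^T.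
set J := (grad A y)^T in Hb *.
apply/esym/eqP; rewrite -subr_eq0 -normr_le0; apply/ler_addgt0Pr => e' e'0.
rewrite add0r; set M := `|d| + 2 + b.
have M0 : 0 < M by rewrite addr_gt0// ltr_wpDl.
pose e := Num.min 1 (e' / M).
have e0 : 0 < e by rewrite lt_min ltr01 divr_gt0.
have e1 : e <= 1 by rewrite ge_min lexx.
have eM : e * M <= e' by rewrite -ler_pdivlMr// ge_min lexx orbT.
apply: le_trans eM; have /near_normP[r r0 Hr] := diff_eps dA e0.
have d1 : 0 < `|d| + 1 by rewrite ltr_wpDl.
have [t [w [/andP[t0 tr] Aw wd]]] := H e (r / (`|d| + 1)) e0 (divr_gt0 r0 d1).
set s := w - (y + t *: d) in wd.
have hE : w - y = s + t *: d by rewrite /s opprD addrA subrK.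
have wy : `|w - y| <= t * (`|d| + 1).
  rewrite hE (le_trans (ler_normD _ _))// normrZ (gtr0_norm t0).
  have : e * t <= 1 * t by rewrite ler_wpM2r// ltW.
  lra.
have := Hr (w - y); rewrite subr0 (le_trans wy)//; last by rewrite -ler_pdivlMr.
move=> /(_ isT); rewrite (addrC y) subrK Aw Ay diff_grad -/J => E1.
rewrite -(ler_pM2l t0) -{1}(gtr0_norm t0) -normrZ.
have -> : t *: (d - J *m d) = (w - y - J *m (w - y)) - (s - J *m s).
  rewrite hE mulmxDr -scalemxAr.
  by move: (J *m s) (J *m d) => u v; apply/matrixP => i j; rewrite !mxE; ring.
rewrite (le_trans (ler_normB _ _))//.
have E2 : `|s - J *m s| <= e * t + b * (e * t).
  rewrite (le_trans (ler_normB _ _))// lerD// (le_trans (Hb _))//.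
  by rewrite ler_wpM2l// ltW.
have E3 := ler_wpM2l (ltW e0) wy.
by rewrite /M; lra.
Qed.

Variables (p r : nat) (X Y : set 'cV[R]_n) (c : 'cV[R]_n -> 'cV[R]_p).
Variables (y : 'cV[R]_n) (tau : R).
Hypothesis Xcl : closed X.
Hypothesis cX : convex_set X.
Hypothesis oY : open Y.
Hypothesis XY : X `<=` Y.
Hypothesis dc : forall w, Y w -> differentiable c w.
Hypothesis cc : {for y, continuous (grad c)}.
Hypothesis Ky : feasible X c y.
Hypothesis tau_gt0 : 0 < tau.
Hypothesis rk : rank_condition X Y c r y tau.

(** A direction of the linearized feasible set is tangent to the feasible set.
    Perturb [y + t d] to a point [z] of [X]; metric regularity of [r]
    independent combinations [T c] of the constraints corrects it to a point of
    [X] where [T c] vanishes; by constant rank [c] vanishes there too. *)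
Lemma feasible_tangent d :
  (forall v, normal_cone X y v -> inner v d <= 0) -> (grad c y)^T *m d = 0 ->
  forall e t0 : R, 0 < e -> 0 < t0 -> exists t w,
    [/\ 0 < t <= t0, feasible X c w & `|w - (y + t *: d)| <= e * t].
Proof.
move=> dN Cd e t0 e0 t00; have [Xy cy0] := Ky.
have Yy : Y y by exact: XY.
have [m [W [XW Waff Wdir]]] := affine_hull_equations Xy.
have by_ : cball y tau y by rewrite /cball /= subrr l2norm0 ltW.
have [B [T [LB TB]]] := has_dim_lift (rk.2 y Xy by_).
have WBj j : W *m col j B = 0.
  by apply: tangent_cone_direction XW _; case: (LB j).
have WB : W *m B = 0.
  by apply/matrixP => i j; have /matrixP /(_ i 0) := WBj j;
    rewrite colE mulmxA -colE !mxE.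
pose DG w := (grad c w)^T.
have cDG : {for y, continuous DG}.
  exact: (@continuous_comp _ _ _ (grad c) trmx y cc (@trmx_continuous R n p _)).
have dcn : \forall w \near y, differentiable c w.
  by have := open_nbhs_nbhs (conj oY Yy); apply: filterS => w; exact: dc.
have rkn : \forall w \near y, W *m (w - y) = 0 -> forall d : 'cV[R]_n,
    W *m d = 0 -> exists a, DG w *m d = DG w *m (B *m a).
  have N1 : \forall w \near y, Y w by exact: open_nbhs_nbhs.
  have N2 : \forall w \near y, cball y tau w.
    apply/near_normP; exists (tau / n.+1%:R) => [|w wy].
      by rewrite divr_gt0.
    rewrite /cball /= (le_trans (l2norm_le_norm _))//.
    rewrite ler_pdivlMr// mulrC in wy; apply: le_trans wy.
    by rewrite ler_wpM2r// ler_nat.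
  have N3 := near_inverse_le cDG TB.
  near=> w => Ww d' Wd'.
  have Yw : Y w by near: w.
  have bw : cball y tau w by near: w.
  have inv : forall a : 'cV[R]_r, `|a| <= 2 * `|T *m DG w *m (B *m a)| by near: w.
  have D := rk.1 w Yw (Waff w Ww) bw.
  have [|||a Ea] := @has_dim_span _ _ _ _ (DG w *m B) D _ _ (DG w *m d').
  - move=> j; exists (col j B); first exact: Wdir.
    by rewrite [RHS]colE -mulmxA -colE.
  - move=> a Na; apply/eqP; rewrite -normr_le0 (le_trans (inv a))//.
    by rewrite -mulmxA [DG w *m _]mulmxA Na mulmx0 normr0 mulr0.
  - by exists d' => //; exact: Wdir.
  by exists a; rewrite Ea mulmxA.
have dcE w u : 'd c w u = DG w *m u by exact: diff_grad.
have [r1 r10 Hr1] := (near_normP _ _).1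
  (constant_rank_vanishing cy0 dcn dcE cDG TB WB rkn).
have [k k0 /near_normP[r2 r20 Hr2]] :=
  metric_regularity cy0 dcn dcE cDG TB Xcl cX LB.
have [b b0 Hb] := mulmx_bound T; have [D D0 HD] := mulmx_bound (DG y).
pose M := 1 + k * b * (D + 1).
have M0 : 0 < M by rewrite addr_gt0// !mulr_gt0// addr_gt0.
(* In the end [w] is at distance at most [M * eta * t] from [y + t *: d]. *)
pose eta := Num.min 1 (e / M).
have eta0 : 0 < eta by rewrite lt_min ltr01 divr_gt0.
have etaM : eta * M <= e by rewrite -ler_pdivlMr// ge_min lexx orbT.
have eta1 : eta <= 1 by rewrite ge_min lexx.
have [u [t1 t10 Xu] ud] := feasible_direction_polar cX Xy dN eta0.
have [t2 t20 Hc] := diff_line u (dc Yy) eta0.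
have d1 : 0 < `|d| + 1 by rewrite ltr_wpDl.
have d2 : 0 < `|d| + e by rewrite ltr_wpDl.
pose t := Num.min (Num.min t0 t1)
  (Num.min t2 (Num.min (r2 / (`|d| + 1)) (r1 / (`|d| + e)))).
have tgt : 0 < t by rewrite !lt_min t00 t10 t20 !divr_gt0.
have [tt0 tt1 tt2 tr2 tr1] : [/\ t <= t0, t <= t1, t <= t2,
    t <= r2 / (`|d| + 1) & t <= r1 / (`|d| + e)].
  by split; rewrite !ge_min lexx ?orbT.
pose z := y + t *: u.
have Xz : X z by apply: Xu; rewrite (ltW tgt).
have zE : z - (y + t *: d) = t *: (u - d).
  by rewrite opprD addrACA subrr add0r scalerBr.
have zd : `|z - (y + t *: d)| <= eta * t.
  by rewrite zE normrZ (gtr0_norm tgt) mulrC ler_wpM2r// ltW.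
have un : `|u| <= `|d| + 1.
  rewrite -[u](subrK d) (le_trans (ler_normD _ _))// addrC lerD2l.
  exact: le_trans ud eta1.
have zy : `|z - y| <= r2.
  rewrite /z addrC addKr normrZ (gtr0_norm tgt).
  rewrite ler_pdivlMr// in tr2; apply: le_trans tr2.
  by rewrite ler_wpM2l// ltW.
have cz : `|c z| <= (D + 1) * (eta * t).
  have := Hc t; rewrite (ltW tgt) tt2 cy0 subr0 dcE -/z => /(_ isT) H1.
  have : `|DG y *m u| <= D * eta.
    have -> : DG y *m u = DG y *m (u - d) by rewrite mulmxBr Cd subr0.
    by rewrite (le_trans (HD _))// ler_wpM2l// ltW.
  move=> /(ler_wpM2l (ltW tgt)) H2.
  rewrite -[c z](subrK (t *: (DG y *m u))) (le_trans (ler_normD _ _))//.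
  by rewrite normrZ (gtr0_norm tgt); lra.
have [w [Xw Tw wz]] := Hr2 z zy Xz.
have wd : `|w - (y + t *: d)| <= e * t.
  have -> : w - (y + t *: d) = (w - z) + (z - (y + t *: d)).
    by rewrite addrA subrK.
  rewrite (le_trans (ler_normD _ _))//.
  have : k * `|T *m c z| <= k * (b * ((D + 1) * (eta * t))).
    rewrite ler_wpM2l ?(ltW k0)// (le_trans (Hb _))//.
    by rewrite ler_wpM2l ?(ltW b0).
  have := ler_wpM2r (ltW tgt) etaM; rewrite /M; lra.
exists t, w; split=> //; first by rewrite tgt.
split=> //; apply: Hr1 => //; last exact: XW.
have -> : w - y = (w - (y + t *: d)) + t *: d by rewrite opprD addrA subrK.
rewrite (le_trans (ler_normD _ _))// normrZ (gtr0_norm tgt).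
rewrite ler_pdivlMr// in tr1; lra.
Unshelve. all: by end_near. Qed.

(** The vector [gradient f y + v] is in the kernel of [grad A y], which equals
    the range of [grad c y] because the derivative of [A] fixes the tangent
    directions of the feasible set. *)
Lemma dissolving_stationary (f : 'cV[R]_n -> R) (A : 'cV[R]_n -> 'cV[R]_n)
    (RA : 'cV[R]_n -> 'M[R]_n) (omega beta : R) :
  (forall z, differentiable f z) -> (forall z, X z -> differentiable A z) ->
  (forall z, feasible X c z -> A z = z /\ grad A z *m grad c z = 0) ->
  RA y = 0 -> 0 < omega -> normal_condition X A RA y omega ->
  cdp_stationary X f c A beta y -> ncp_stationary X f c y.
Proof.
move=> df dA AK RA0 omega0 NA [Xy [v Nv]].
have [_ cy0] := Ky; have [Ay JC] := AK y Ky.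
rewrite gradient_cdp_obj; [|exact: dA|exact: df|exact/dc/XY].
rewrite cy0 mulmx0 scaler0 addr0 Ay => Ev.
have JN u : normal_cone X y u -> grad A y *m u = u.
  move=> Nu; have by_ : cball y omega y by rewrite /cball /= subrr l2norm0 ltW.
  have := NA y Xy by_ u Nu; rewrite RA0 subr0 mulmxBl mul1mx => /eqP.
  by rewrite subr_eq0 => /eqP.
have [m [M [NM MN]]] := spanning_columns (normal_cone X y).
have [||||a Ea] :=
  @kernel_range _ _ _ m (grad A y) (grad c y) M (gradient f y + v).
- by rewrite mulmxDr (JN _ Nv) -Ev.
- exact: JC.
- apply/matrixP => i j; have /matrixP /(_ i 0) := JN _ (NM j).
  by rewrite colE mulmxA -!colE !mxE.
- move=> d Cd Md; apply: diff_fixed_direction => //; first exact: dA.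
  have dN u : normal_cone X y u -> inner u d <= 0.
    by move=> /MN[a ->]; rewrite inner_mulmxl Md inner0r.
  move=> e t0 e0 t00.
  have [t [w [tt Kw wd]]] := feasible_tangent dN Cd e0 t00.
  by exists t, w; split=> //; case: (AK w Kw).
split=> //; exists (- a), v; split=> //.
by rewrite mulmxN -Ea addrAC subrr.
Qed.

End TangentDirections.

Theorem theorem3p10 (R : realType) (n p : nat)
    (X Y : set 'cV[R]_n) (f : 'cV[R]_n -> R) (c : 'cV[R]_n -> 'cV[R]_p)
    (A : 'cV[R]_n -> 'cV[R]_n) (RA : 'cV[R]_n -> 'M[R]_n)
    (r : nat) (Yt : set 'cV[R]_n)
    (setting : ncp_setting X Y)
    (regular : regular_data X Y f c r)
    (dissolving : constraint_dissolving X c A RA)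
    (constant_rank : constant_rank_nbhd X Y c Yt)
    (x : 'cV[R]_n) (feasible_x : feasible X c x)
    (tau omega kappa rho : R)
    (tau_gt0 : 0 < tau) (tauP : rank_condition X Y c r x tau)
    (omega_gt0 : 0 < omega) (omegaP : normal_condition X A RA x omega)
    (kappa_gt0 : 0 < kappa) (kappaP : error_bound_condition X Y c Yt r x kappa)
    (rhoP : is_largest
              (radii X c r x (Num.min tau (Num.min omega kappa))) rho)
    (y : 'cV[R]_n) (Omega_y : Omega X c A RA r x rho y)
    (beta : R) (beta_ge0 : 0 <= beta)
    (beta_ge : (beta_min X f c A RA r x rho <= beta%:E)%E) :
  ((pi_ X c r x * beta)%:E
     / (8%:E * (M_A X A x rho + M_R X c RA x rho + 1))
     * (l2norm (c y))%:E
   <= (dist 0 [set (gradient (cdp_obj f c A beta) y + v)%R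
              | v in normal_cone X y])%:E)%E
  /\ (0 < beta ->
      cdp_stationary X f c A beta y -> ncp_stationary X f c y).
Proof.
have [Xcl cX oY XY] := setting.
have [[df _ _] [dc cc _] _ rk] := regular.
have [[dA _ _] AK _ RA0 NA] := dissolving.
have [_ XYt _ _] := constant_rank.
have [Xx cx0] := feasible_x.
have Mx : manifold X c Yt x by split; [exact: XYt|exact: mem_aff|].
have [[/andP[_ rho_le] _] _] := rhoP.
have [_ rho_omega rho_kappa] : [/\ rho <= tau, rho <= omega & rho <= kappa].
  by move: rho_le; rewrite !le_min => /and3P.
have df' z : differentiable f z by exact: df.
split.
  exact: (dist_gradient_cdp_ge cX XY df' dc dA feasible_x omegaP kappaP).
move=> beta_gt0 Sy.
have cy0 : c y = 0.
  exact: (cdp_stationary_feasible cX XY df' dc dA feasible_x omegaP kappaP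
    rho_omega rho_kappa Omega_y beta_ge0 beta_ge Mx beta_gt0 Sy).
have Ky : feasible X c y by split=> //; case: Omega_y.
have [tau_y tau_y0 rky] := rk y Ky.
have [omega_y omega_y0 NAy] := NA y Ky.
have ccy : {for y, continuous (grad c)}.
  move: cc; rewrite continuous_open_subspace// => /(_ y); apply.
  by apply/mem_set/XY; case: Ky.
exact: (dissolving_stationary Xcl cX oY XY dc ccy Ky tau_y0 rky df' dA AK
  (RA0 y Ky) omega_y0 NAy Sy).
Qed.
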